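(* Let $W_n=\{\alpha\in[0,1]:\ \alpha n\in\mathbb N \text{ and } \tfrac{1-\alpha}{2}n\in\mathbb N\}$. The Error-Tolerant auction $M$ (defined in the context) is a value-strategyproof and time-strategyproof online auction that, given parameters $\alpha\in W_n$ and $\gamma\in[0,1]$, and a prediction $\tilde v_{(1)}$ with unknown quality $q=\min\left\{\frac{\tilde v_{(1)}}{v_{(1)}},\frac{v_{(1)}}{\tilde v_{(1)}}\right\}$, achieves $$\mathbb E_{\Theta\sim\mu(V,I)}[\mathrm{Rev}(M(\Theta,\tilde v_{(1)}))]\ \ge\ \begin{cases}\max\left\{\alpha\gamma q\cdot v_{(1)},\ \frac{1-\alpha^2}{4}\cdot v_{(2)}\right\} & \text{if } q\ge\gamma,\\[4pt] \frac{1-\alpha^2}{4}\cdot v_{(2)} & \text{if } q<\gamma.\end{cases}$$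
   Context: **Model.** A single item is sold to a set $N=\{1,\dots,n\}$ of bidders. Bidder $i$ has a private type $\theta_i=(a_i,d_i,v_i)$ with arrival time $a_i$, departure time $d_i\ge a_i$ and value $v_i$ for the item. Bidder $i$ may misreport her value, may delay the announcement of her arrival (report $\hat a_i> a_i$, but never earlier than $a_i$), and may report a false departure time $\hat d_i$ (earlier or later than $d_i$). If the item is allocated to a bidder $i$ at time $t$ at price $p$, her utility is $v_i-p$ if $t\in[a_i,d_i]$ and $-p$ otherwise; all other bidders have utility $0$. An auction is strategyproof if for every bidder truthfully reporting her type is a dominant strategy, i.e., maximizes her utility whatever types the others report; value-strategyproofness means bidders cannot benefit from misreporting their value, and time-strategyproofness is the additional requirement that they cannot benefit from misreporting arrival or departure times either. An auction is online if a decision to allocate at time $t$ is irrevocable, and this decision and the payment depend only on information about bidders with arrival time at most $t$. Bidders are indexed by order of departure (bidder $i$ is the $i$-th to depart). An arbitrary fixed total order $\pi$ on bidders is used for tie-breaking; $i\succ j$ means $i$ is ranked before $j$ in $\pi$. **Random matching.** A set $V$ of $n$ values, with highest value $v_{(1)}$ and second-highest value $v_{(2)}$, and a set $I=\{[a_1,d_1],\dots,[a_n,d_n]\}$ of $n$ arrival-departure intervals are chosen adversarially; $\mu(V,I)$ is the random type profile $\Theta$ obtained by matching values to intervals uniformly at random. The auction is also given a prediction $\tilde v_{(1)}\ge 0$ of $v_{(1)}$. $\mathrm{Rev}(M(\Theta,\tilde v_{(1)}))$ is the revenue of auction $M$ on type profile $\Theta$ with prediction $\tilde v_{(1)}$.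 **Error-Tolerant auction with parameters $\alpha,\gamma$ and prediction $\tilde v_{(1)}$.** It is obtained from an auction called Three-Phase (the case $\gamma=1$) by one change only: the second-phase threshold $\max\{v_{\max},\tilde v_{(1)}\}$ is replaced by $\max\{v_{\max},\gamma\cdot\tilde v_{(1)}\}$. Explicitly: *Allocation rule, $\textsc{Alloc}(n,\Theta,\alpha,\tilde v_{(1)})$, for $n$ bidders with types $\Theta$.* Initialize: active set $A=\emptyset$, departed set $L=\emptyset$, $v_{\max}=0$, threshold $\tau=\infty$, winner $i^*=0$, flag active-winner $=$ false. While not all bidders have departed, process the events over time: - If some bidder $i$ arrives (ties broken by $\pi$): add $i$ to $A$; if $v_i\ge\tau$, set $i^*=i$ and stop the loop. - Else, if some bidder $i$ departs (ties broken by $\pi$): move $i$ from $A$ to $L$ and set $v_{\max}\leftarrow\max\{v_{\max},v_i\}$. Then, if $|L|=\lceil\frac{1-\alpha}{2}n\rceil$, set $\tau\leftarrow\max\{v_{\max},\gamma\cdot\tilde v_{(1)}\}$ (start of the second phase); else if $|L|=\lfloor\frac{1+\alpha}{2}n\rfloor$, set $\tau\leftarrow v_{\max}$ (start of the third phase). Then, if there is a bidder $i\in A$ with $v_i\ge\tau$, set active-winner $=$ true, set $i^*$ to such a bidder (ties broken by $\pi$) and stop the loop. Return $i^*$, $\tau$, active-winner. *Payment rule.* Given the output $i^*,\tau$, active-winner of $\textsc{Alloc}(n,\Theta,\alpha,\tilde v_{(1)})$, set $p=\tau$. If $\tau=\tilde v_{(1)}$ and $i^*>\lfloor\frac{1+\alpha}{2}n\rfloor$,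 run the simulation without $i^*$, $(i',\tau',\text{active-winner}')=\textsc{Alloc}(n-1,\Theta_{-i^*},\alpha,\tilde v_{(1)})$, where $\Theta_{-i^*}$ is the profile with $i^*$ removed; if active-winner$'$ is false or $i^*\succ i'$, set $p=\tau'$. The winner $i^*$ (if any) receives the item at her reported departure time and pays $p$.
   Formalization: The auction is corrected: the rerun without the winner keeps the phase boundaries computed from n, not n-1; the payment test is τ=γ·ṽ(1) instead of τ=ṽ(1); for α=0 the third phase starts when the boundaries coincide; for α=1 the second phase starts before any departure. *)

(* Defs.v *)
From HB Require Import structures.
From mathcomp Require Import all_boot all_order all_algebra all_fingroup.
From mathcomp Require Import reals constructive_ereal.

Set Implicit Arguments.
Unset Strict Implicit.
Unset Printing Implicit Defensive.

Import Order.TTheory GRing.Theory Num.Theory.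
Local Open Scope ring_scope.

Section Auctions.
Variables (R : realType) (n : nat).

Record bidder_type := BidderType { arrival : R; departure : R; value : R }.

Definition valid_type (th : bidder_type) : Prop :=
  arrival th <= departure th /\ 0 <= value th.

Definition profile := 'I_n -> bidder_type.

Definition valid_profile (Th : profile) : Prop := forall i, valid_type (Th i).

Definition with_report (Th : profile) (i : 'I_n) (r : bidder_type) : profile :=
  fun j => if j == i then r else Th j.

Record allocation := Allocation { winner : 'I_n; time : R; price : R }.

(* [None] means that the item is not sold. *)
Definition auction := profile -> option allocation.

Definition utility (th : bidder_type) (i : 'I_n) (o : option allocation) : R :=
  if o is Some x then
    if winner x == i then
      (if arrival th <= time x <= departure th then value th else 0) - price x
    else 0
  else 0.

Definition revenue (o : option allocation) : R :=
  if o is Some x then price x else 0.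

(* In the next two definitions [Th i] is the true type of [i], and [Th j],
   for [j] different from [i], is the arbitrary report of [j]. *)
Definition value_strategyproof (M : auction) : Prop :=
  forall (Th : profile) (i : 'I_n) (v : R),
    valid_profile Th -> 0 <= v ->
    utility (Th i) i
      (M (with_report Th i (BidderType (arrival (Th i)) (departure (Th i)) v)))
    <= utility (Th i) i (M Th).

(* The arrival can only be delayed, the departure is unconstrained, and the
   value may be misreported at the same time. *)
Definition time_strategyproof (M : auction) : Prop :=
  forall (Th : profile) (i : 'I_n) (r : bidder_type),
    valid_profile Th -> valid_type r -> arrival (Th i) <= arrival r ->
    utility (Th i) i (M (with_report Th i r)) <= utility (Th i) i (M Th).

(* Whether the item is allocated at time [t], to whom and at which price, is
   determined by the types of the bidders that arrive no later than [t].  As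
   an outcome has a single allocation, allocations are irrevocable. *)
Definition online (M : auction) : Prop :=
  forall (Th Th' : profile) (t : R),
    valid_profile Th -> valid_profile Th' ->
    (forall j, arrival (Th j) <= t \/ arrival (Th' j) <= t -> Th j = Th' j) ->
    forall (i : 'I_n) (p : R),
      M Th = Some (Allocation i t p) -> M Th' = Some (Allocation i t p).

Section ErrorTolerant.
(* [pi i] is the rank of bidder [i] in the tie-breaking order; [prediction]
   predicts the highest value. *)
Variables (pi : 'S_n) (alpha gamma prediction : R).

Definition before (i j : 'I_n) : bool := (pi i < pi j)%N.

Definition second_phase_start : nat := `|Num.ceil ((1 - alpha) / 2 * n%:R)|%N.
Definition third_phase_start : nat := `|Num.floor ((1 + alpha) / 2 * n%:R)|%N.

Inductive event := Arrival of 'I_n | Departure of 'I_n.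

Definition event_time (Th : profile) (e : event) : R :=
  match e with
  | Arrival i => arrival (Th i)
  | Departure i => departure (Th i)
  end.

(* Simultaneous events: arrivals precede departures, and two events of the
   same kind are ordered by [pi]. *)
Definition event_tie (e f : event) : bool :=
  match e, f with
  | Arrival i, Arrival j => (pi i <= pi j)%N
  | Arrival _, Departure _ => true
  | Departure _, Arrival _ => false
  | Departure i, Departure j => (pi i <= pi j)%N
  end.

Definition event_le (Th : profile) (e f : event) : bool :=
  (event_time Th e < event_time Th f)
  || (event_time Th e == event_time Th f) && event_tie e f.

Definition events (Th : profile) (S : {set 'I_n}) : seq event :=
  sort (event_le Th)
    ([seq Arrival i | i <- enum S] ++ [seq Departure i | i <- enum S]).

Record state := State {
  active : {set 'I_n};
  departed : {set 'I_n};
  vmax : R;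
  threshold : \bar R;
  selected : option 'I_n;
  active_winner : bool }.

(* [k] bidders have departed, their highest value is [vm], and [tau] is the
   current threshold.  The third phase has precedence, so that the second one
   is empty when the two boundaries coincide, i.e. when [alpha = 0]. *)
Definition phase_threshold (k : nat) (vm : R) (tau : \bar R) : \bar R :=
  if k == third_phase_start then vm%:E
  else if k == second_phase_start then (Num.max vm (gamma * prediction))%:E
  else tau.

(* The boundaries are already tested with no departed bidder, so that the
   first phase is empty when [alpha = 1]. *)
Definition initial_state : state :=
  State set0 set0 0 (phase_threshold 0 0 +oo%E) None false.

Definition first_in_order (A : {set 'I_n}) : option 'I_n :=
  [pick i in A | [forall j in A, (pi i <= pi j)%N]].

Definition step (Th : profile) (s : state) (e : event) : state :=
  if selected s is Some _ then s else
  match e with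
  | Arrival i =>
      State (i |: active s) (departed s) (vmax s) (threshold s)
        (if (threshold s <= (value (Th i))%:E)%E then Some i else None) false
  | Departure i =>
      let A := active s :\ i in
      let L := i |: departed s in
      let vm := Num.max (vmax s) (value (Th i)) in
      let tau := phase_threshold #|L| vm (threshold s) in
      let w := first_in_order [set j in A | (tau <= (value (Th j))%:E)%E] in
      State A L vm tau w (isSome w)
  end.

(* The allocation rule run on the bidders in [S] only.  The phase boundaries
   are those of the auction with all [n] bidders, whatever [S] is: in a rerun
   without the winner, boundaries recomputed from [n - 1] would start the third
   phase one departure too early, and the price would not be strategyproof. *)
Definition alloc (Th : profile) (S : {set 'I_n}) : state :=
  foldl (step Th) initial_state (events Th S).

(* Position of [i] in the order of departure, starting from 1. *)
Definition departure_index (Th : profile) (i : 'I_n) : nat :=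
  #|[set j | (departure (Th j) < departure (Th i))
           || (departure (Th j) == departure (Th i)) && before j i]|.+1.

(* A price equal to [gamma * prediction] is one set by the prediction.  If it
   were compared with [prediction] instead, such a price would not be revised
   when [gamma < 1], and a winner of the second phase could gain by delaying
   her arrival to the third one. *)
Definition payment (Th : profile) (i : 'I_n) (tau : \bar R) : \bar R :=
  if (tau == (gamma * prediction)%:E)
     && (third_phase_start < departure_index Th i)%N
  then
    let s := alloc Th [set~ i] in
    if ~~ active_winner s || oapp (before i) false (selected s)
    then threshold s else tau
  else tau.

(* [fine] only ever removes an injection here: no bidder is selected before the
   threshold becomes finite, and the rerun in [payment] reaches the third phase
   unless it stops earlier with a finite threshold. *)
Definition error_tolerant : auction := fun Th =>
  let s := alloc Th [set: 'I_n] in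
  if selected s is Some i then
    Some (Allocation i (departure (Th i)) (fine (payment Th i (threshold s))))
  else None.

End ErrorTolerant.

(* Bidder [i] has the interval [Iv i] and the value with index [s i]. *)
Definition matching (V : n.-tuple R) (Iv : 'I_n -> R * R) (s : 'S_n) : profile :=
  fun i => BidderType (Iv i).1 (Iv i).2 (tnth V (s i)).

Definition expected_revenue (M : auction) (V : n.-tuple R)
    (Iv : 'I_n -> R * R) : R :=
  (\sum_(s : 'S_n) revenue (M (matching V Iv s))) / #|{: 'S_n}|%:R.

(* [kth_highest V 1] is the highest value, with multiplicities; the value is 0
   if there is no [k]-th one, i.e. for the second-highest value when [n = 1],
   where [alpha = 1] and it has coefficient 0. *)
Definition kth_highest (V : n.-tuple R) (k : nat) : R :=
  (sort >=%R V)`_(k.-1).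

Definition parameter_set (alpha : R) : Prop :=
  [/\ 0 <= alpha <= 1, alpha * n%:R \is a Num.nat
    & (1 - alpha) / 2 * n%:R \is a Num.nat].

End Auctions.

(* Division by 0 gives 0, hence quality 0 when exactly one argument is 0, which
   is also the limit value; when both are 0 the revenue bounds are 0 anyway. *)
Definition quality (R : realType) (prediction v1 : R) : R :=
  Num.min (prediction / v1) (v1 / prediction).

(* Main.v *)
Require Import Defs.
From HB Require Import structures.
From mathcomp Require Import all_boot all_order all_algebra all_fingroup.
From mathcomp Require Import reals constructive_ereal ring.

(** Fix a bidder i and the reports of the others.  The run of the auction on
    the others alone does not depend on the report of i, and the report of i
    only decides between which two positions x <= y of that run she is present.
    The run with i coincides with it until i is selected, so i wins at the first
    position of [x, y] where its threshold is at most her value and where it has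
    not stopped, or stops by selecting an active bidder ranked after i.  Away
    from the infinite initial threshold, the thresholds decrease at most once, at
    the start of the third phase.  If i departs before, she pays the threshold of
    the second phase; if she departs later, she pays the final threshold of the
    run without her whenever she would still win at that threshold.  A delayed
    arrival or an early departure shrinks [x, y] and can only raise the price.

    For the revenue, the departure order does not depend on the matching.  If
    the highest value is at least gamma times the prediction, and departs in the
    second phase, which has probability alpha, then the price is at least gamma
    times the prediction.  Let c be the number of departures that start the
    second phase if the highest value is at least gamma times the prediction, and
    the third phase otherwise.  If the second-highest value is among the first c
    departures and the highest is not, every finite threshold is at least the
    second-highest value and the highest value ensures a sale; this has
    probability at least c (n - c) / n^2 = (1 - alpha^2) / 4. *)

Set Implicit Arguments.
Unset Strict Implicit.
Unset Printing Implicit Defensive.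

Import Order.TTheory GRing.Theory Num.Theory.
Local Open Scope ring_scope.

(** * Event lists and their coherence *)

Section EventEqType.
Variable n : nat.

(** A detour through a sum type, from which [event n] inherits decidable equality. *)
Definition sum_of_event (e : event n) : 'I_n + 'I_n :=
  match e with Arrival i => inl i | Departure i => inr i end.
Definition event_of_sum (x : 'I_n + 'I_n) : event n :=
  match x with inl i => Arrival i | inr i => Departure i end.
Lemma sum_of_eventK : cancel sum_of_event event_of_sum.
Proof. by case. Qed.

HB.instance Definition _ := Equality.copy (event n) (can_type sum_of_eventK).

Lemma arrival_inj : injective (@Arrival n).
Proof. by move=> i j []. Qed.

Lemma departure_inj : injective (@Departure n).
Proof. by move=> i j []. Qed.

Definition bidder_of (e : event n) : 'I_n :=
  match e with Arrival i | Departure i => i end.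

Definition departures (l : seq (event n)) : {set 'I_n} :=
  [set j | Departure j \in l].

Lemma departures_rcons_arrival l i :
  departures (rcons l (Arrival i)) = departures l.
Proof. by apply/setP => j; rewrite !inE mem_rcons inE. Qed.

Lemma departures_rcons_departure l i :
  departures (rcons l (Departure i)) = i |: departures l.
Proof.
by apply/setP => j; rewrite !inE mem_rcons inE (inj_eq departure_inj).
Qed.

Lemma departures_cat l l' :
  departures (l ++ l') = departures l :|: departures l'.
Proof. by apply/setP => j; rewrite !inE mem_cat. Qed.

(** All that the analysis of a run needs to know about the order of events; it mentions no times and
    passes to prefixes. *)
Definition coherent (l : seq (event n)) : Prop :=
  uniq l /\ forall p j q, l = p ++ Departure j :: q -> Arrival j \in p.

Lemma coherent_prefix p q : coherent (p ++ q) -> coherent p.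
Proof.
case; rewrite cat_uniq => /andP[Up _] H; split=> // p1 j p2 Ep.
by apply: (H _ _ (p2 ++ q)); rewrite Ep -catA.
Qed.

Lemma coherent_rcons l e : coherent (rcons l e) -> coherent l.
Proof. by rewrite -cats1; apply: coherent_prefix. Qed.

Lemma coherent_arrival l i : coherent (rcons l (Arrival i)) ->
  Departure i \notin l.
Proof.
case; rewrite rcons_uniq => /andP[nA _] H; apply: contra nA => Di.
case/splitPr: Di H => p q /(_ p i (rcons q (Arrival i))).
by rewrite rcons_cat /= mem_cat => ->.
Qed.

Lemma coherent_departure l i : coherent (rcons l (Departure i)) ->
  Arrival i \in l /\ Departure i \notin l.
Proof.
by case; rewrite rcons_uniq => /andP[-> _] /(_ l i nil); rewrite cats1 => ->.
Qed.

Lemma coherent_take k l : coherent l -> coherent (take k l).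
Proof. by rewrite -{1}(cat_take_drop k l); apply: coherent_prefix. Qed.

End EventEqType.

(** * Thresholds *)

Section Run.
Variables (R : realType) (n : nat) (pi : 'S_n) (alpha gamma prediction : R).

Local Notation K := (second_phase_start n alpha).
Local Notation M := (third_phase_start n alpha).
Local Notation g := (gamma * prediction).

Hypothesis KM : (K <= M)%N.

(* By [runP], the threshold after [k] departures with highest value [vm]. *)
Definition stage_threshold (k : nat) (vm : R) : \bar R :=
  if (M <= k)%N then vm%:E
  else if (K <= k)%N then (Num.max vm g)%:E else +oo%E.

Lemma stage_threshold_ge k vm : (vm%:E <= stage_threshold k vm)%E.
Proof.
rewrite /stage_threshold; case: ifP => // _; case: ifP => _; last exact: leey.
by rewrite lee_fin le_max lexx.
Qed.

(* When the third phase starts, only a threshold set by the prediction drops. *)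
Lemma stage_threshold_stable k vm v :
  (v%:E < stage_threshold k vm)%E -> stage_threshold k vm != +oo%E ->
  (k.+1 != M) || (stage_threshold k vm != g%:E) ->
  stage_threshold k.+1 (Num.max vm v) = stage_threshold k vm.
Proof.
rewrite /stage_threshold; case: (leqP M k) => [Mk|kM].
  by rewrite (leqW Mk) lte_fin => /ltW/max_idPl ->.
case: (leqP K k) => // Kk; rewrite lte_fin (leqW Kk) => vlt _.
have [kM1|kM1] /= := eqVneq k.+1 M.
  rewrite kM1 leqnn; move: vlt; rewrite /Num.max.
  case: ifP => [_ _|]; first by rewrite eqxx.
  by move=> _ vlt _; rewrite ltNge (ltW vlt).
move=> _; rewrite leqNgt ltn_neqAle kM1 kM /= maxAC.
by move/ltW/max_idPl: vlt => ->.
Qed.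

Lemma stage_threshold_decr k vm v :
  (v%:E < stage_threshold k vm)%E ->
  (stage_threshold k.+1 (Num.max vm v) <= stage_threshold k vm)%E.
Proof.
move=> vlt; have [->|fin] := eqVneq (stage_threshold k vm) +oo%E.
  exact: leey.
case: (boolP ((k.+1 != M) || (stage_threshold k vm != g%:E))) => [st|].
  by rewrite stage_threshold_stable.
rewrite negb_or negbK => /andP[/eqP kM _].
(* The new threshold is [v], below the old one by hypothesis, or [vm], below every threshold of its
   stage. *)
rewrite {1}/stage_threshold kM leqnn /Num.max.
by case: ifP => _; [exact: ltW|exact: stage_threshold_ge].
Qed.

(** [phase_threshold] acts only when a boundary is hit exactly, whereas [stage_threshold] is a
    closed form in [k]. Between boundaries they agree because the departing value lies below the
    threshold and cannot raise it. *)
Lemma phase_threshold_stage k vm v :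
  (v%:E < stage_threshold k vm)%E ->
  phase_threshold n alpha gamma prediction k.+1 (Num.max vm v)
    (stage_threshold k vm) = stage_threshold k.+1 (Num.max vm v).
Proof.
move=> vlt; rewrite /phase_threshold.
have [kM|kM] := eqVneq k.+1 M; first by rewrite /stage_threshold kM leqnn.
have [kK|kK] := eqVneq k.+1 K.
  by rewrite /stage_threshold kK leqnn leqNgt ltn_neqAle -{1}kK kM KM.
have [fin|/esym fin] := eqVneq (stage_threshold k vm) +oo%E; last first.
  by rewrite stage_threshold_stable ?kM //; apply/eqP => /esym.
rewrite fin; move: fin; rewrite /stage_threshold.
case: (leqP M k) => // kM1; case: (leqP K k) => // kK1 _.
by rewrite (leqNgt M) (leqNgt K) ![(k.+1 < _)%N]ltn_neqAle kM kK kM1 kK1.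
Qed.

Lemma first_in_order_some (A : {set 'I_n}) i :
  first_in_order pi A = Some i <->
  i \in A /\ (forall j, j \in A -> (pi i <= pi j)%N).
Proof.
rewrite /first_in_order; case: pickP => [k /andP[kA /forall_inP kmin]|none].
  split=> [[<-] //|[iA imin]]; congr Some; apply: (@perm_inj _ pi).
  by apply/val_inj/eqP; rewrite eqn_leq kmin ?imin.
split=> // -[iA imin]; have := none i; rewrite iA /=.
by move/negbT/negP; case; apply/forall_inP.
Qed.

Lemma first_in_order_none (A : {set 'I_n}) :
  first_in_order pi A = None <-> A = set0.
Proof.
split=> [none|->]; last first.
  by rewrite /first_in_order; case: pickP => // i; rewrite inE.
apply/setP => i; rewrite inE; apply/negP => iA.
case: (arg_minnP (fun j => pi j : nat) iA) => k kA kmin.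
by have := proj2 (first_in_order_some A k) (conj kA kmin); rewrite none.
Qed.

Section Profile.
Variable Th : profile R n.

Local Notation v := (fun j => value (Th j)).
Local Notation step := (step pi alpha gamma prediction Th).

Definition run_from (s : state R n) (l : seq (event n)) : state R n :=
  foldl step s l.

Definition run (l : seq (event n)) : state R n :=
  run_from (initial_state n alpha gamma prediction) l.

Lemma run_cat p q : run (p ++ q) = run_from (run p) q.
Proof. exact: foldl_cat. Qed.

Lemma run_rcons l e : run (rcons l e) = step (run l) e.
Proof. exact: foldl_rcons. Qed.

Lemma step_selected s e : selected s -> step s e = s.
Proof. by rewrite /Defs.step; case: (selected s). Qed.

Lemma run_from_selected s l : selected s -> run_from s l = s.
Proof. by move=> ss; elim: l => //= e l IH; rewrite step_selected. Qed.

(** Invariant of a run. A sale freezes the state while events go on, hence a mere inclusion for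
    [departed]; as long as nobody is selected, the events determine the active and departed sets. *)
Record run_spec (l : seq (event n)) (s : state R n) : Prop := RunSpec {
  run_threshold : threshold s = stage_threshold #|departed s| (vmax s);
  run_vmax_ge0 : 0 <= vmax s;
  run_vmax_ge : forall j, j \in departed s -> v j <= vmax s;
  run_vmax_le : forall c, 0 <= c -> (forall j, v j <= c) -> vmax s <= c;
  run_departed : departed s \subset departures l;
  run_selected : forall i, selected s = Some i ->
    Arrival i \in l /\ (threshold s <= (v i)%:E)%E;
  run_unselected : selected s = None ->
    [/\ departed s = departures l,
        active s = [set j | (Arrival j \in l) && (Departure j \notin l)],
        active_winner s = false
      & forall j, j \in active s -> ((v j)%:E < threshold s)%E] }.

Lemma runP l : coherent l -> run_spec l (run l).
Proof.
elim/last_ind: l => [_|l e IH cl].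
  split=> //=.
  - rewrite cards0 /phase_threshold /stage_threshold !leqn0 ![_ == 0%N]eq_sym.
    by [].
  - by move=> j; rewrite inE.
  - by move=> _; split=> // j; rewrite inE.
have cl0 : coherent l := coherent_rcons cl.
rewrite run_rcons; case: {IH cl0}(IH cl0) => thr vm0 vmge vmle dep sel unsel.
set s := run l in thr vm0 vmge vmle dep sel unsel *.
case sel_s: (selected s) => [i|].
  rewrite step_selected ?sel_s //; split=> //.
  - apply/(subset_trans dep)/subsetP => j.
    by rewrite !inE mem_rcons inE => ->; rewrite orbT.
  - move=> j /sel[Aj ?]; split=> //.
    by rewrite mem_rcons inE Aj orbT.
  - by rewrite sel_s.
case: unsel => // depE actE awE low; rewrite /Defs.step sel_s.
case: e cl => i cl.
  split=> //=.
  - by rewrite departures_rcons_arrival.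
  - move=> j; case: ifP => // le_thr [<-]; split=> //.
    by rewrite mem_rcons mem_head.
  - case: ifP => // /negbT; rewrite -ltNge => lt_thr _; split=> //.
    + by rewrite departures_rcons_arrival.
    + apply/setP => j; rewrite actE !inE !mem_rcons !inE /=.
      rewrite (inj_eq (@arrival_inj n)).
      have [->|//] := eqVneq j i; rewrite /=.
      by rewrite coherent_arrival.
    + by move=> j; rewrite !inE => /predU1P[->|/low].
(* The departing bidder was active and unselected, so her value is below the threshold, as
   [phase_threshold_stage] requires. *)
have [Ai nDi] := coherent_departure cl.
have iact : i \in active s by rewrite actE inE Ai.
have idep : i \notin departed s by rewrite depE inE.
have ilow := low i iact; rewrite thr in ilow.
split=> /=.
- by rewrite cardsU1 idep add1n thr phase_threshold_stage.
- by rewrite le_max vm0.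
- move=> j; rewrite !inE => /predU1P[->|/vmge vj]; rewrite le_max ?lexx ?orbT //.
  by rewrite vj.
- by move=> c c0 vc; rewrite ge_max vmle ?vc.
- by rewrite departures_rcons_departure setUS.
- move=> j /first_in_order_some[]; rewrite !inE -andbA => /and3P[_ ja le_thr] _.
  split=> //; rewrite mem_rcons inE; move: ja; rewrite actE inE => /andP[-> _].
  by rewrite orbT.
- move=> /first_in_order_none none; split.
  + by rewrite depE departures_rcons_departure.
  + apply/setP => j; rewrite !inE actE !inE !mem_rcons !inE /=.
    by rewrite (inj_eq (@departure_inj n)) negb_or andbCA.
  + by move: none => /first_in_order_none ->.
  + move=> j ja; rewrite ltNge; apply/negP => le_thr.
    by have := in_set0 j; rewrite -none inE ja le_thr.
Qed.


Lemma alloc_run (S : {set 'I_n}) :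
  alloc pi alpha gamma prediction Th S = run (events pi Th S).
Proof. by []. Qed.

Lemma run_step l e : coherent (rcons l e) -> selected (run l) = None ->
  threshold (run (rcons l e)) = threshold (run l) \/
  exists i, let k := #|departures l| in let vm := vmax (run l) in
    [/\ departures (rcons l e) = i |: departures l, i \notin departures l,
        threshold (run l) = stage_threshold k vm,
        ((v i)%:E < stage_threshold k vm)%E
      & threshold (run (rcons l e)) = stage_threshold k.+1 (Num.max vm (v i))].
Proof.
move=> cl sel; have cl0 : coherent l := coherent_rcons cl.
have [depE actE _ low] := run_unselected (runP cl0) sel.
have thr := run_threshold (runP cl0).
case: e cl => i cl; rewrite run_rcons /Defs.step sel /=; [by left|right].
exists i; have [Ai nDi] := coherent_departure cl.
have ni : i \notin departures l by rewrite inE.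
have iact : i \in active (run l) by rewrite actE inE Ai.
have := low i iact; rewrite thr depE => ilow; split=> //.
  exact: departures_rcons_departure.
by rewrite cardsU1 ni add1n phase_threshold_stage.
Qed.

Lemma threshold_decr p q : coherent (p ++ q) ->
  (threshold (run (p ++ q)) <= threshold (run p))%E.
Proof.
elim/last_ind: q => [|q e IH]; first by rewrite cats0.
rewrite -rcons_cat => cl.
have cl0 : coherent (p ++ q) := coherent_rcons cl.
apply: le_trans (IH cl0).
case sel: (selected (run (p ++ q))) => [i|].
  by rewrite run_rcons step_selected ?sel.
case: (run_step cl sel) => [->//|[i [_ _ -> low ->]]].
exact: stage_threshold_decr.
Qed.

(** A finite threshold can drop only from [g], at the start of the third phase. Each alternative
    excludes this: the phase is not reached, has already begun, or the threshold is not [g]. *)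
Lemma threshold_stable p q : coherent (p ++ q) ->
  threshold (run p) != +oo%E ->
  [|| (#|departures (p ++ q)| < M)%N, (M <= #|departures p|)%N
    | threshold (run p) != g%:E] ->
  threshold (run (p ++ q)) = threshold (run p).
Proof.
move=> + fin; elim/last_ind: q => [|q e IH]; first by rewrite cats0.
rewrite -rcons_cat => cl st.
have cl0 : coherent (p ++ q) := coherent_rcons cl.
have sub : (#|departures (p ++ q)| <= #|departures (rcons (p ++ q) e)|)%N.
  by rewrite subset_leq_card // -cats1 (departures_cat (p ++ q)) subsetUl.
have {}IH : threshold (run (p ++ q)) = threshold (run p).
  apply: IH => //; case/or3P: st => [lt|->|->]; rewrite ?orbT //.
  by rewrite (leq_ltn_trans sub).
rewrite -IH in fin st *.
case sel: (selected (run (p ++ q))) => [i|].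
  by rewrite run_rcons step_selected ?sel.
case: (run_step cl sel) => [->//|[i [depE ni thr low ->]]].
rewrite thr stage_threshold_stable -?thr //; first by rewrite thr.
case/or3P: st => [|le|]; last by move=> ->; rewrite orbT.
  by rewrite depE cardsU1 ni add1n => /ltn_eqF ->.
apply/orP; left; rewrite gtn_eqF // ltnS (leq_trans le) //.
by rewrite subset_leq_card // departures_cat subsetUl.
Qed.

(** An active bidder was below the threshold just before her selection, so the threshold must have
    dropped to reach her value. *)
Lemma active_winner_threshold p q : coherent (p ++ q) ->
  selected (run p) = None -> active_winner (run (p ++ q)) ->
  (threshold (run (p ++ q)) < threshold (run p))%E.
Proof.
move=> + selp; elim/last_ind: q => [|q e IH].
  by rewrite cats0 => /runP/run_unselected[] // _ _ ->.
rewrite -rcons_cat => cl.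
have cl0 : coherent (p ++ q) := coherent_rcons cl.
case sel: (selected (run (p ++ q))) => [i|].
  by rewrite run_rcons step_selected ?sel //; apply: IH.
have [_ _ _ low] := run_unselected (runP cl0) sel.
move=> aw; apply: lt_le_trans (threshold_decr cl0).
move: aw; rewrite run_rcons /Defs.step sel; case: e cl => // i cl /=.
case first: first_in_order => [j|//] _.
move/first_in_order_some: first => [].
rewrite !inE -andbA => /and3P[_ ja le_thr] _.
exact: le_lt_trans le_thr (low j ja).
Qed.

Lemma passive_selection l e : selected (run l) = None ->
  selected (run (rcons l e)) -> ~~ active_winner (run (rcons l e)) ->
  threshold (run (rcons l e)) = threshold (run l).
Proof.
by rewrite run_rcons /Defs.step => ->; case: e => //= i; case: first_in_order.
Qed.

Lemma third_phase_threshold_fin l : coherent l -> (M <= #|departures l|)%N ->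
  selected (run l) = None -> threshold (run l) != +oo%E.
Proof.
move=> cl Ml sel; have [depE _ _ _] := run_unselected (runP cl) sel.
by rewrite (run_threshold (runP cl)) depE /stage_threshold Ml.
Qed.

(** The last possible drop is over, and selecting an active bidder would need another one. *)
Lemma third_phase_final p q : coherent (p ++ q) ->
  (M <= #|departures p|)%N -> selected (run p) = None ->
  threshold (run (p ++ q)) = threshold (run p)
  /\ active_winner (run (p ++ q)) = false.
Proof.
move=> cl Mp sel.
have fin := third_phase_threshold_fin (coherent_prefix cl) Mp sel.
have thr := threshold_stable cl fin; rewrite Mp orbT in thr.
split; first exact: thr.
apply/negP => /(active_winner_threshold cl sel).
by rewrite thr // ltxx.
Qed.

Lemma selected_not_departed l e i : coherent (rcons l e) ->
  selected (run l) = None -> selected (run (rcons l e)) = Some i ->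
  Departure i \notin rcons l e.
Proof.
move=> cl sel; have cl0 : coherent l := coherent_rcons cl.
have [depE actE _ low] := run_unselected (runP cl0) sel.
rewrite run_rcons /Defs.step sel; case: e cl => j cl /=.
  by case: ifP => // _ [<-]; rewrite mem_rcons inE /= coherent_arrival.
move=> /first_in_order_some[]; rewrite !inE actE !inE -andbA => /and3P[nij + _] _.
case/andP=> _ nD; rewrite mem_rcons inE negb_or nD andbT.
by rewrite (inj_eq (@departure_inj n)).
Qed.

(** Only bidders who have not departed get selected, so the selection of [i] cannot come after
    [l]. *)
Lemma selected_before_departure l q i : coherent (l ++ q) ->
  Departure i \in l -> selected (run (l ++ q)) = Some i ->
  selected (run l) = Some i.
Proof.
elim/last_ind: q => [|q e IH]; first by rewrite cats0.
rewrite -rcons_cat => cl Di.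
have cl0 : coherent (l ++ q) := coherent_rcons cl.
case sel: (selected (run (l ++ q))) => [j|].
  rewrite run_rcons step_selected ?sel // => -[ji].
  by apply: IH; rewrite // sel ji.
move/(selected_not_departed cl sel).
by rewrite mem_rcons inE mem_cat Di orbT.
Qed.

(** * The run with and without a bidder *)

Section Simulation.
(** [p], [q] and [r] are the events of the others before the arrival of [i], during her presence,
    and after her departure. *)
Variables (i : 'I_n) (p q r : seq (event n)).
Hypothesis cl : coherent (p ++ q ++ r).
Hypothesis clA : coherent (p ++ Arrival i :: q ++ Departure i :: r).

Local Notation base := (p ++ q ++ r).
Local Notation s_ k := (run (take k base)).

(* Position [k] of the run on [l], the events of the other bidders, is one where
   [i], present since position [x], is selected unless she was selected before.
   The second disjunct is the tie with the bidder selected at that position. *)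
Definition winning (l : seq (event n)) (x k : nat) : Prop :=
  (threshold (run (take k l)) <= (v i)%:E)%E /\
  (selected (run (take k l)) = None \/
   [/\ (x < k)%N, selected (run (take k.-1 l)) = None,
       active_winner (run (take k l))
     & oapp (before pi i) false (selected (run (take k l)))]).

Definition add_active (s : state R n) : state R n :=
  State (i |: active s) (departed s) (vmax s) (threshold s) None false.

Let no_arrival : Arrival i \notin base.
Proof.
case: clA => + _; rewrite -cat1s uniq_catCA cat1s cons_uniq => /andP[+ _].
by apply: contraNN; rewrite !mem_cat inE => /or3P[]->; rewrite ?orbT.
Qed.

Let no_departure : Departure i \notin base.
Proof.
case: clA => + _.
rewrite -cat_cons catA -(cat1s (Departure i)) uniq_catCA cat1s cons_uniq.
case/andP=> + _; apply: contraNN; rewrite !mem_cat inE.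
by case/or3P=> ->; rewrite ?orbT.
Qed.

(** Induction on the events since the arrival of [i]. Until a winning position occurs, the two runs
    differ only by [i] in the active set, or both have selected somebody; who is selected instead of
    [i] is irrelevant. *)
Lemma simulation q1 q2 : q = q1 ++ q2 ->
  let x := size p in let y := (size p + size q1)%N in
  let m := run (p ++ Arrival i :: q1) in
  (exists k, [/\ (x <= k <= y)%N, winning base x k, selected m = Some i,
     threshold m = threshold (s_ k)
     & forall k', (x <= k' < k)%N -> ~ winning base x k']) \/
  ((forall k, (x <= k <= y)%N -> ~ winning base x k) /\
   if selected (s_ y) is Some j then exists2 j', selected m = Some j' & j' != i
   else m = add_active (s_ y)).
Proof.
move=> Eq x y; elim/last_ind: q1 q2 @y Eq => [|q1 e IH] q2 y Eq m.
  have Exy k : (x <= k <= y)%N -> k = x.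
    by rewrite /y addn0 => kx; apply/eqP; rewrite eqn_leq andbC.
  have s_x : run (take x base) = run p by rewrite take_size_cat.
  have s_y : run (take y base) = run p by rewrite /y addn0.
  rewrite s_y {}/m cats1 run_rcons /Defs.step.
  case sel: (selected (run p)) => [j|].
    right; split.
      move=> k /Exy -> [_ []]; first by rewrite s_x sel.
      by case; rewrite ltnn.
    rewrite sel; exists j => //; apply: contraNneq no_arrival => <-.
    have cp : coherent p by apply: coherent_prefix cl.
    by have [? _] := run_selected (runP cp) sel; rewrite mem_cat; apply/orP; left.
  case: ifPn => [le_thr|nle_thr]; [left; exists x|right]; rewrite /=.
    split=> //.
    - by rewrite leqnn leq_addr.
    - by split; rewrite s_x //; left.
    - by rewrite s_x.
    - by move=> k' /andP[/leq_ltn_trans H /H]; rewrite ltnn.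
  split=> // k /Exy -> [+ _]; rewrite s_x => le_thr.
  by rewrite le_thr in nle_thr.
rewrite cat_rcons in Eq.
set y0 := (size p + size q1)%N.
have Ey : y = y0.+1 by rewrite /y size_rcons addnS.
have tk : take y base = rcons (take y0 base) e.
  have -> : base = (p ++ q1) ++ e :: (q2 ++ r) by rewrite Eq -!catA.
  rewrite Ey (@take_size_cat _ y0) ?size_cat // -cat_rcons.
  by rewrite take_size_cat // size_rcons size_cat.
have cy : coherent (rcons (take y0 base) e) by rewrite -tk; apply: coherent_take.
have ey : e \in base by rewrite Eq !mem_cat mem_head !orbT.
have {IH} := IH _ Eq; rewrite -/y0.
set m0 := run (p ++ Arrival i :: q1) => IH.
have {m}-> : m = step m0 e by rewrite /m -rcons_cons -rcons_cat run_rcons.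
rewrite tk run_rcons -/x.
have le_y k : (x <= k <= y)%N -> (x <= k <= y0)%N \/ k = y.
  case/andP=> xk; rewrite leq_eqVlt Ey ltnS xk.
  by case/predU1P=> ->; [right|left].
case: IH => [[k [/andP[xk ky] wink sel thr kmin]]|[nwin st]].
  left; exists k; rewrite xk Ey (leqW ky) step_selected ?sel //.
have x_lt_y : (x < y)%N by rewrite Ey ltnS leq_addr.
set s := s_ y0 in nwin st *; set G := (X in X \/ _).
(* The condition [winning] at the new position, as a condition on the state after [e]. *)
pose win_y s' := (threshold s' <= (v i)%:E)%E /\
  (selected s' = None \/ [/\ selected s = None, active_winner s'
                           & oapp (before pi i) false (selected s')]).
have winningE : winning base x y <-> win_y (step s e).
  rewrite /winning /win_y tk run_rcons Ey /= -/s -Ey x_lt_y.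
  by split=> -[le_thr [selN|[]]]; split=> //; [left|right|left|right].
have lose : ~ win_y (step s e) -> forall k, (x <= k <= y)%N -> ~ winning base x k.
  by move=> nwin_y k /le_y[/nwin|->] // /winningE.
have win : win_y (step s e) -> selected (step m0 e) = Some i ->
    threshold (step m0 e) = threshold (step s e) -> G.
  move=> win_y_e sel thr; exists y; split=> //.
  - by rewrite leqnn ltnW.
  - exact/winningE.
  - by rewrite tk run_rcons.
  - by move=> k; rewrite Ey ltnS => /nwin.
clearbody G y.
case sel: (selected s) st => [j|].
  move=> [j' selm j'i]; right; split.
    apply: lose; rewrite step_selected ?sel // => -[_ []]; rewrite sel //.
    by case.
  by rewrite !step_selected ?selm ?sel //; exists j'.
move=> m0E.
have [depE actE _ low] := run_unselected (runP (coherent_take y0 cl)) sel.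
have inact : i \notin active s.
  rewrite actE inE negb_and; apply/orP; left.
  by apply: contra no_arrival => /mem_take.
(* Nobody is selected at [y0], so a threshold at most the value of [i] would make [y0] winning. *)
have high : (threshold s <= (v i)%:E)%E = false.
  apply/negP => le_thr; apply: (nwin y0); first by rewrite leq_addr leqnn.
  by split=> //; left.
move: lose win; rewrite {}m0E /win_y /Defs.step sel.
(* An arrival does not move the threshold, so [i] stays below it; only a departure can let her
   win. *)
case: e ey {tk cy Eq winningE} => j jbase /= lose win.
  right; split; first by apply: lose => -[]; rewrite high.
  case: ifP => _; last by rewrite /add_active /= setUCA.
  by exists j => //; apply: contraNneq no_arrival => <-.
have ji : j != i by apply: contraNneq no_departure => <-.
move: lose win.
set dep := j |: departed s; set vm := Num.max _ _.
set thr := phase_threshold _ _ _ _ _ _ _.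
have -> : (i |: active s) :\ j = i |: (active s :\ j).
  apply/setP => k; rewrite !inE; have [->|//] := eqVneq k i.
  by rewrite eq_sym ji.
set A := active s :\ j.
have iA : i \notin A by rewrite inE negb_and inact orbT.
set W := [set k in A | _].
case: (boolP (thr <= (v i)%:E)%E) => thr_i lose win; last first.
  have -> : [set k in i |: A | (thr <= (v k)%:E)%E] = W.
    apply/setP => k; rewrite !inE; have [->|//] := eqVneq k i.
    by rewrite (negbTE thr_i) !andbF.
  right; split; first by apply: lose => -[].
  case first: first_in_order => [k|//]; exists k => //.
  move/first_in_order_some: first => [+ _]; apply: contraTneq => ->.
  by rewrite inE (negbTE iA).
move: win.
have -> : [set k in i |: A | (thr <= (v k)%:E)%E] = i |: W.
  by apply/setP => k; rewrite !inE; have [->|] := eqVneq k i.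
move=> win; case first: (first_in_order pi W) lose win => [k|] /= lose win.
  (* [i] now competes with [k], the first of the other eligible active bidders, and [pi] decides. *)
  case: (boolP (before pi i k)) => ik.
    left; apply: win => //; first by split=> //; right.
    apply/first_in_order_some; split; first exact: setU11.
    move=> l /setU1P[->//|lW].
    move/first_in_order_some: first => [_ /(_ l lW)].
    exact/leq_trans/ltnW.
  right; split.
    by apply: lose => -[_ [//|[_ _]]]; rewrite (negbTE ik).
  have [kW kmin] := proj1 (first_in_order_some W k) first.
  exists k; last by apply: contraTneq kW => ->; rewrite inE (negbTE iA).
  apply/first_in_order_some; split; first by rewrite inE kW orbT.
  by move=> l /setU1P[->|/kmin//]; rewrite leqNgt.
left; apply: win => //; first by split=> //; left.
move/first_in_order_none: first => ->; rewrite setU0.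
by apply/first_in_order_some; split; [exact: set11|move=> l /set1P ->].
Qed.

Lemma simulation_outcome :
  let x := size p in let y := (size p + size q)%N in
  let m := run (p ++ Arrival i :: q ++ Departure i :: r) in
  (selected m = Some i -> exists k,
     [/\ (x <= k <= y)%N, winning base x k & threshold m = threshold (s_ k)]) /\
  (forall k', (x <= k' <= y)%N -> winning base x k' -> exists k,
     [/\ (x <= k <= k')%N, selected m = Some i & threshold m = threshold (s_ k)]).
Proof.
move=> x y m; have Eq : q = q ++ [::] by rewrite cats0.
have mE : m = run_from (run (p ++ Arrival i :: q)) (Departure i :: r).
  by rewrite -run_cat -catA.
have := simulation Eq; rewrite -/x -/y.
case=> [[k [xky wink sel thr kmin]]|[nwin st]].
  rewrite mE run_from_selected ?sel //; split=> [_|k' xk'y wink'].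
    by exists k.
  exists k; split=> //; move: xky xk'y => /andP[-> _] /andP[xk' _] /=.
  by rewrite leqNgt; apply/negP => k'k; apply: (kmin k') => //; rewrite xk'.
(* Without a winning position [i] is still unselected just before her departure, and neither that
   event nor a later one can select her. *)
split=> [selm|k' xk'y /(nwin _ xk'y)//]; exfalso.
have cl1 : coherent (rcons (p ++ Arrival i :: q) (Departure i) ++ r).
  by rewrite cat_rcons -catA.
have Di : Departure i \in rcons (p ++ Arrival i :: q) (Departure i).
  by rewrite mem_rcons mem_head.
have selD : selected (run (rcons (p ++ Arrival i :: q) (Departure i))) = Some i.
  by apply: (selected_before_departure cl1) => //; rewrite cat_rcons -catA.
case sel: (selected (run (p ++ Arrival i :: q))) => [j|].
  case: (selected (s_ y)) st => [_ [j' + j'i]|stE].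
    rewrite sel => -[jj']; move: selD.
    rewrite run_rcons step_selected sel // => -[ji].
    by rewrite -jj' ji eqxx in j'i.
  by move: sel; rewrite stE.
have := selected_not_departed (coherent_prefix cl1) sel selD.
by rewrite Di.
Qed.

End Simulation.

(** * The order of events *)

Lemma event_le_total : total (event_le pi Th).
Proof.
move=> e f; rewrite /event_le.
case: (ltgtP (event_time Th e) (event_time Th f)) => //= _.
by case: e f => i [] j //=; apply: leq_total.
Qed.

Lemma event_le_trans : transitive (event_le pi Th).
Proof.
move=> f e h; rewrite /event_le.
case/orP=> [ef|/andP[/eqP-> tef]].
  case/orP=> [fh|/andP[/eqP<- _]]; last by rewrite ef.
  by rewrite (lt_trans ef fh).
case/orP=> [->//|/andP[-> tfh]]; apply/orP; right => /=.
by case: e f h tef tfh => i [] j [] k //=; apply: leq_trans.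
Qed.

Lemma event_le_anti : antisymmetric (event_le pi Th).
Proof.
move=> e f; rewrite /event_le.
case: (ltgtP (event_time Th e) (event_time Th f)) => //= _.
by case: e f => i [] j //= /anti_leq/val_inj/perm_inj ->.
Qed.

Lemma mem_events (S : {set 'I_n}) e :
  (e \in events pi Th S) = (bidder_of e \in S).
Proof.
rewrite mem_sort mem_cat; case: e => i /=.
  rewrite (mem_map (@arrival_inj n)) mem_enum.
  by rewrite (_ : (_ \in map _ _) = false) ?orbF //; apply/mapP => -[].
rewrite (mem_map (@departure_inj n)) mem_enum.
by rewrite (_ : (_ \in map _ _) = false) //; apply/mapP => -[].
Qed.

Lemma events_uniq (S : {set 'I_n}) : uniq (events pi Th S).
Proof.
rewrite sort_uniq cat_uniq !map_inj_uniq ?enum_uniq //=.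
- by rewrite andbT; apply/hasPn => e /mapP[i _ ->]; apply/mapP => -[].
- exact: departure_inj.
- exact: arrival_inj.
Qed.

Lemma events_sorted (S : {set 'I_n}) : sorted (event_le pi Th) (events pi Th S).
Proof. exact/sort_sorted/event_le_total. Qed.

(** The order is antisymmetric, so a sorted duplicate-free list is determined by its members; this
    recognizes event lists obtained by deletion or for another profile. *)
Lemma events_unique (S : {set 'I_n}) l :
  uniq l -> sorted (event_le pi Th) l ->
  (forall e, (e \in l) = (bidder_of e \in S)) -> l = events pi Th S.
Proof.
move=> Ul sl ml; apply: (sorted_eq event_le_trans event_le_anti) => //.
  exact: events_sorted.
by apply: uniq_perm => //; [exact: events_uniq|move=> e; rewrite ml mem_events].
Qed.

Lemma sorted_split e p q : sorted (event_le pi Th) (p ++ e :: q) ->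
  uniq (p ++ e :: q) ->
  (forall f, f \in p -> event_le pi Th f e) /\
  (forall f, f \in q -> ~~ event_le pi Th f e).
Proof.
rewrite (sorted_pairwise event_le_trans) pairwise_cat /=.
case/and3P=> /allrelP pe _ /andP[/allP eq _].
rewrite cat_uniq => /and3P[_ _ /andP[/negP neq _]]; split=> f.
  by move=> fp; apply: pe; rewrite ?mem_head.
move=> fq; apply/negP => fe.
have fe' : f = e by apply: event_le_anti; rewrite fe eq.
by apply: neq; rewrite -fe'.
Qed.

Hypothesis vTh : valid_profile Th.

(** An arrival is no later than the departure of the same bidder, and ties in time put arrivals
    first. *)
Lemma events_coherent (S : {set 'I_n}) : coherent (events pi Th S).
Proof.
split=> [|p j q Ep]; first exact: events_uniq.
have := sorted_split; move=> /(_ (Departure j) p q); rewrite -Ep.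
case/(_ (events_sorted S) (events_uniq S)) => _ after.
have := mem_events S (Arrival j).
rewrite -[bidder_of _]/(bidder_of (Departure j)).
rewrite -mem_events Ep !mem_cat mem_head orbT inE /= => /orP[//|/after].
rewrite /event_le /= lt_neqAle; case: (vTh j) => -> _.
by rewrite andbT andbC /= orbC; case: eqP.
Qed.

Lemma mem_events_prefix (S : {set 'I_n}) e p q :
  events pi Th S = p ++ e :: q ->
  forall f, (f \in p) = [&& bidder_of f \in S, f != e & event_le pi Th f e].
Proof.
move=> Ep f; have := events_uniq S; have := events_sorted S.
rewrite Ep => so U; have [pe qe] := sorted_split so U.
rewrite -mem_events Ep mem_cat inE; have [->|fe] := eqVneq f e.
  move: U; rewrite cat_uniq /= negb_or andbF.
  by case/and3P=> _ /andP[/negbTE].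
case: (boolP (f \in p)) => [/pe ->//|_] /=.
by case: (boolP (f \in q)) => // /qe /negbTE ->.
Qed.

Definition departs_before (j i : 'I_n) : bool :=
  (departure (Th j) < departure (Th i))
  || (departure (Th j) == departure (Th i)) && before pi j i.

Lemma event_le_departure j i :
  (Departure j != Departure i) && event_le pi Th (Departure j) (Departure i) =
  departs_before j i.
Proof.
rewrite (inj_eq (@departure_inj n)) /event_le /departs_before /= /before.
have [->|ji] := eqVneq j i; first by rewrite ltxx eqxx ltnn.
by rewrite ltn_neqAle (inj_eq val_inj) (inj_eq perm_inj) ji.
Qed.

Lemma departures_prefix (S : {set 'I_n}) i p q :
  events pi Th S = p ++ Departure i :: q ->
  departures p = [set j in S | departs_before j i].
Proof.
move=> /mem_events_prefix pE; apply/setP => j.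
by rewrite !inE pE event_le_departure.
Qed.

Lemma departures_split (S : {set 'I_n}) i : i \in S ->
  exists p q, [/\ events pi Th S = p ++ Departure i :: q, Arrival i \in p
    & departures p = [set j in S | departs_before j i]].
Proof.
move=> iS; have Di : Departure i \in events pi Th S by rewrite mem_events.
case/splitPr: {-1}_ / Di (erefl (events pi Th S)) => p q E.
exists p, q; split=> //.
  exact: (proj2 (events_coherent S)) E.
exact: departures_prefix E.
Qed.

Lemma departure_indexE i :
  departure_index pi Th i = #|[set j | departs_before j i]|.+1.
Proof. by []. Qed.

(** * The outcome for a fixed bidder, read off the run of the others *)

Section Outcome.
Variable i : 'I_n.

Local Notation base := (events pi Th [set~ i]).
Local Notation s_ k := (run (take k base)).

(** Positions are counts of preceding events, so that the effect of a delay is a comparison of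
    counts. *)
Definition arrival_position : nat :=
  count (fun f => event_le pi Th f (Arrival i)) base.

Definition departure_position : nat :=
  count (fun f => event_le pi Th f (Departure i)) base.

Local Notation x := arrival_position.
Local Notation y := departure_position.

Lemma count_sorted_split e p q :
  sorted (event_le pi Th) (p ++ e :: q) -> uniq (p ++ e :: q) ->
  count (fun f => event_le pi Th f e) p = size p
  /\ count (fun f => event_le pi Th f e) q = 0%N.
Proof.
move=> so U; have [pe qe] := sorted_split so U; split.
  by apply/eqP; rewrite -all_count; apply/allP.
by apply/eqP; rewrite -leqn0 leqNgt -has_count; apply/hasPn.
Qed.

(** Deleting the two events of [i] from the full list leaves a sorted list of the events of the
    others. *)
Lemma events_insert : exists p q r,
  [/\ base = p ++ q ++ r,
      events pi Th [set: 'I_n] = p ++ Arrival i :: q ++ Departure i :: r,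
      size p = x & (size p + size q)%N = y].
Proof.
have [p0 [r [Er Ap _]]] := departures_split (in_setT i).
case/splitPr: Ap Er => p q; rewrite -catA /= => E.
have so := events_sorted [set: 'I_n]; have U := events_uniq [set: 'I_n].
have mem e := mem_events [set: 'I_n] e.
rewrite E in so U mem.
have perm : perm_eq (p ++ Arrival i :: q ++ Departure i :: r)
                    (Arrival i :: Departure i :: p ++ q ++ r).
  rewrite -cat1s perm_catCA /= perm_cons catA -(cat1s (Departure i)).
  by rewrite perm_catCA /= perm_cons catA.
have Eb : base = p ++ q ++ r.
  apply/esym/events_unique.
  - by move: U; rewrite (perm_uniq perm) /= => /and3P[].
  - apply: (subseq_sorted event_le_trans _ so).
    apply: cat_subseq => //; apply: subseq_trans (subseq_cons _ _).
    by apply: cat_subseq => //; apply: subseq_cons.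
  - move=> e; have := mem e; rewrite (perm_mem perm) !inE.
    move: U; rewrite (perm_uniq perm) cons_uniq inE negb_or.
    case/andP=> /andP[_ nA] /andP[nD _]; case: e => j /=;
      rewrite ?(inj_eq (@arrival_inj n)) ?(inj_eq (@departure_inj n)).
      by have [->|] := eqVneq j i; rewrite ?(negbTE nA).
    by have [->|] := eqVneq j i; rewrite ?(negbTE nD).
have [pA qrA] := count_sorted_split so U.
rewrite -cat_cons catA in so U; have [pqD rD] := count_sorted_split so U.
exists p, q, r; rewrite /arrival_position /departure_position Eb; split=> //.
  move: qrA; rewrite !count_cat pA /= => /eqP; rewrite !addn_eq0.
  by case/and3P=> /eqP-> _ /eqP->; rewrite !addn0.
rewrite !count_cat rD addn0; move: pqD; rewrite count_cat size_cat /=.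
have -> : event_le pi Th (Arrival i) (Departure i).
  have := events_sorted [set: 'I_n]; rewrite (sorted_pairwise event_le_trans) E.
  by rewrite pairwise_cat /= all_cat /= => /and4P[_ _ /and3P[]].
by rewrite add1n !addnS => -[].
Qed.

Lemma take_departure_position :
  departures (take y base) = [set j | departs_before j i].
Proof.
have [p [q [r [-> E _ <-]]]] := events_insert.
rewrite catA -size_cat take_size_cat //.
rewrite -cat_cons catA in E; apply/setP => j.
have /setP/(_ j) := departures_prefix E; rewrite !inE /= => <-.
by rewrite !mem_cat inE.
Qed.

Lemma alloc_outcome :
  let m := alloc pi alpha gamma prediction Th [set: 'I_n] in
  (selected m = Some i -> exists k,
     [/\ (x <= k <= y)%N, winning i base x k & threshold m = threshold (s_ k)]) /\
  (forall k', (x <= k' <= y)%N -> winning i base x k' -> exists k,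
     [/\ (x <= k <= k')%N, selected m = Some i & threshold m = threshold (s_ k)]).
Proof.
have [p [q [r [Eb E <- <-]]]] := events_insert.
have := @simulation_outcome i p q r; rewrite /alloc E Eb; apply.
  by rewrite -Eb; apply: events_coherent.
by rewrite -E; apply: events_coherent.
Qed.

Local Notation final := (alloc pi alpha gamma prediction Th [set~ i]).

(** The test of [payment] on the departure index of [i], in terms of the run of the others. *)
Definition late : bool := (M <= #|departures (take y base)|)%N.

Definition revisable : bool :=
  ~~ active_winner final || oapp (before pi i) false (selected final).

(* The price if [i] is selected at position [k].  The test [tau == g] of
   [payment] disappears: a finite threshold other than [g] is final. *)
Definition winning_price (k : nat) : \bar R :=
  if late && revisable then threshold final else threshold (s_ k).

Lemma run_take_split j k : (j <= k)%N ->
  exists q, take k base = take j base ++ q.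
Proof.
move=> jk; exists (drop j (take k base)).
by rewrite -{1}(cat_take_drop j (take k base)) take_takel.
Qed.

Lemma coherent_take_base k : coherent (take k base).
Proof. exact/coherent_take/events_coherent. Qed.

Lemma final_split k : final = run (take k base ++ drop k base).
Proof. by rewrite cat_take_drop. Qed.

Lemma coherent_split k : coherent (take k base ++ drop k base).
Proof. by rewrite cat_take_drop; apply: events_coherent. Qed.

Lemma final_decr k : (threshold final <= threshold (s_ k))%E.
Proof. by rewrite (final_split k); apply/threshold_decr/coherent_split. Qed.

Lemma final_selected k : selected (s_ k) -> final = s_ k.
Proof.
by move=> sel; rewrite (final_split k) run_cat; apply: run_from_selected.
Qed.

Lemma final_late k : (M <= #|departures (take k base)|)%N ->
  selected (s_ k) = None ->
  threshold final = threshold (s_ k) /\ active_winner final = false.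
Proof.
by rewrite (final_split k); apply/third_phase_final/coherent_split.
Qed.

Lemma winning_price_le k : (winning_price k <= threshold (s_ k))%E.
Proof. by rewrite /winning_price; case: ifP => // _; apply: final_decr. Qed.

Lemma payment_winning_price k : threshold (s_ k) != +oo%E ->
  payment pi alpha gamma prediction Th i (threshold (s_ k)) = winning_price k.
Proof.
move=> fin; rewrite /payment departure_indexE ltnS -take_departure_position.
rewrite -/late /winning_price /revisable.
case: late; rewrite /= ?andbT ?andbF //; case: eqP => // /eqP ng.
rewrite [threshold final](_ : _ = threshold (s_ k)); first by case: ifP.
rewrite (final_split k); apply: threshold_stable; rewrite ?ng ?orbT //.
exact: coherent_split.
Qed.

Lemma winning_fin k : winning i base x k -> threshold (s_ k) != +oo%E.
Proof. by case=> + _; apply: contraTneq => ->; rewrite leye_eq. Qed.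

Local Notation M_ := (error_tolerant pi alpha gamma prediction).

Lemma outcome_win a : M_ Th = Some a -> winner a = i -> exists k,
  [/\ (x <= k <= y)%N, winning i base x k
    & a = Allocation i (departure (Th i)) (fine (winning_price k))].
Proof.
rewrite /error_tolerant; case sel: selected => [j|//] [<-] /= ji.
rewrite {}ji in sel *.
have [k [xky wink thr]] := proj1 alloc_outcome sel.
exists k; split=> //; rewrite thr payment_winning_price //.
exact: winning_fin wink.
Qed.

Lemma winning_outcome k' : (x <= k' <= y)%N -> winning i base x k' ->
  exists k, [/\ (x <= k <= k')%N, (threshold (s_ k) <= (v i)%:E)%E
    & M_ Th = Some (Allocation i (departure (Th i)) (fine (winning_price k)))].
Proof.
move=> xky wink; have [_ /(_ _ xky wink)[k [xkk' sel thr]]] := alloc_outcome.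
have le_thr : (threshold (s_ k) <= (v i)%:E)%E.
  rewrite -thr.
  by case: (run_selected (runP (events_coherent [set: 'I_n])) sel).
exists k; split=> //; rewrite /error_tolerant sel thr payment_winning_price //.
by apply: contraTneq le_thr => ->; rewrite leye_eq.
Qed.

End Outcome.

Lemma threshold_ge0 l : coherent l -> (0 <= threshold (run l))%E.
Proof.
move=> /runP cl; rewrite (run_threshold cl).
apply: le_trans (stage_threshold_ge _ _).
by rewrite lee_fin (run_vmax_ge0 cl).
Qed.

Lemma winning_price_ge0 i k : (0 <= winning_price i k)%E.
Proof.
by rewrite /winning_price; case: ifP => _; apply: threshold_ge0;
  [apply: events_coherent|apply: coherent_take_base].
Qed.

(** A truthful winner gets the item within her interval, at a price bounded by the threshold that
    selected her, hence by her value. *)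
Lemma utility_ge0 i :
  0 <= utility (Th i) i (error_tolerant pi alpha gamma prediction Th).
Proof.
case out: error_tolerant => [a|//]; rewrite /utility; case: eqP => // wi.
have [k [_ [le_thr _] ->]] := outcome_win out wi.
rewrite /= lexx (proj1 (vTh i)) /= subr_ge0 -lee_fin.
have le := le_trans (winning_price_le i k) le_thr.
by rewrite fineK // ge0_fin_numE ?winning_price_ge0 // (le_lt_trans le) ?ltry.
Qed.

End Profile.

(** * Comparison of runs on different profiles *)

Lemma leq_count_in (T : eqType) (a b : pred T) (l : seq T) :
  (forall z, z \in l -> a z -> b z) -> (count a l <= count b l)%N.
Proof.
move=> ab; have -> : count a l = count (predI a (mem l)) l.
  by apply: eq_in_count => z zl /=; rewrite zl andbT.
by apply: sub_count => z /andP[az zl]; apply: ab.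
Qed.

Lemma event_le_eq (Th Th' : profile R n) e f :
  Th (bidder_of e) = Th' (bidder_of e) -> Th (bidder_of f) = Th' (bidder_of f) ->
  event_le pi Th e f = event_le pi Th' e f.
Proof.
move=> eqe eqf; rewrite /event_le.
have timeE h : Th (bidder_of h) = Th' (bidder_of h) ->
    event_time Th h = event_time Th' h by case: h => j /= ->.
by rewrite !timeE.
Qed.

Lemma event_le_delay (Th Th' : profile R n) e f :
  event_time Th f = event_time Th' f -> event_time Th e <= event_time Th' e ->
  event_le pi Th f e -> event_le pi Th' f e.
Proof.
rewrite /event_le => <-; rewrite le_eqVlt => /predU1P[<- //|lt].
case/orP=> [ltf|/andP[/eqP-> _]]; last by rewrite lt.
by rewrite (lt_trans ltf lt).
Qed.

Lemma events_eq (Th Th' : profile R n) (S : {set 'I_n}) :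
  (forall j, j \in S -> Th j = Th' j) -> events pi Th S = events pi Th' S.
Proof.
move=> eqS; apply: events_unique => [||e]; last exact: mem_events.
  exact: events_uniq.
rewrite -(@eq_in_sorted _ (mem (events pi Th S)) (event_le pi Th)).
- exact: events_sorted.
- move=> e f; rewrite !mem_events => eS fS.
  by apply: event_le_eq; apply: eqS.
- exact/allP.
Qed.

Lemma run_eq (Th Th' : profile R n) l :
  (forall e, e \in l -> Th (bidder_of e) = Th' (bidder_of e)) ->
  run Th l = run Th' l.
Proof.
(* A departure step reads the values of all active bidders, so the induction also carries their
   agreement. *)
move=> eql; suff: run Th l = run Th' l /\
    (forall j, j \in active (run Th l) -> Th j = Th' j) by case.
elim/last_ind: l eql => [|l e IH] eql; first by split=> // j; rewrite inE.
rewrite !run_rcons; have [|<- act] := IH.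
  by move=> f fl; apply: eql; rewrite mem_rcons inE fl orbT.
have {eql} := eql e; rewrite mem_rcons mem_head => /(_ isT).
rewrite /Defs.step; case: (selected (run Th l)) => [//|].
case: e => j /= eqj; first by rewrite eqj; split=> // k /setU1P[->|/act].
rewrite eqj; split; last by move=> k /setD1P[_ /act].
set tau := phase_threshold _ _ _ _ _ _ _.
suff -> : [set k in active (run Th l) :\ j | (tau <= (value (Th k))%:E)%E] =
    [set k in active (run Th l) :\ j | (tau <= (value (Th' k))%:E)%E] by [].
apply/setP => k; rewrite !inE.
by have [/act->|] := boolP (k \in active (run Th l)); rewrite ?andbF.
Qed.

Lemma first_change (P : pred nat) a b : ~~ P a -> P b -> (a <= b)%N ->
  exists k, [/\ (a <= k < b)%N, ~~ P k & P k.+1].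
Proof.
move=> Pa; elim: b => [|b IH] Pb.
  by rewrite leqn0 => /eqP ab; rewrite ab Pb in Pa.
rewrite leq_eqVlt => /predU1P[ab|]; first by rewrite ab Pb in Pa.
rewrite ltnS => ab.
case: (boolP (P b)) => [/IH/(_ ab)[k [/andP[ak kb] nPk Pk]]|nPb].
  by exists k; rewrite ak ltnW.
by exists b; rewrite ab ltnSn.
Qed.

(** * Strategyproofness *)

Section Misreport.
(** [Th] contains the true type of [i] and [Th'] her misreport. *)
Variables (Th Th' : profile R n) (i : 'I_n).
Hypothesis vTh : valid_profile Th.
Hypothesis vTh' : valid_profile Th'.
Hypothesis others : forall j, j != i -> Th j = Th' j.
Hypothesis arr : arrival (Th i) <= arrival (Th' i).

Local Notation base := (events pi Th [set~ i]).
Local Notation s_ k := (run Th (take k base)).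
Local Notation final := (alloc pi alpha gamma prediction Th [set~ i]).
Local Notation x := (arrival_position Th i).
Local Notation x' := (arrival_position Th' i).
Local Notation y := (departure_position Th i).
Local Notation y' := (departure_position Th' i).
Local Notation M_ := (error_tolerant pi alpha gamma prediction).

Let others_base : events pi Th' [set~ i] = base.
Proof. by apply/esym/events_eq => j; rewrite !inE => /others. Qed.

Let bidder_base e : e \in base -> Th (bidder_of e) = Th' (bidder_of e).
Proof. by rewrite mem_events !inE => /others. Qed.

Let others_run k : run Th' (take k base) = s_ k.
Proof. by apply/esym/run_eq => e /mem_take/bidder_base. Qed.

Let others_final : alloc pi alpha gamma prediction Th' [set~ i] = final.
Proof. by rewrite /alloc others_base; apply/esym/run_eq/bidder_base. Qed.

Let x_le : (x <= x')%N.
Proof.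
rewrite /arrival_position others_base; apply: leq_count_in => e /bidder_base eqe.
by apply: event_le_delay => //; case: e eqe => j /= ->.
Qed.

Let y_le : departure (Th' i) <= departure (Th i) -> (y' <= y)%N.
Proof.
rewrite /departure_position others_base => dep.
apply: leq_count_in => e /bidder_base eqe.
by apply: event_le_delay => //; case: e eqe => j /= ->.
Qed.

(** The truthful arrival position is no later, so the tie alternative survives; only the comparison
    with the true value must be supplied. *)
Let winning_truth k : winning Th' i base x' k ->
  (threshold (s_ k) <= (value (Th i))%:E)%E -> winning Th i base x k.
Proof.
move=> [_ +] le_thr; rewrite !others_run => alt; split=> //.
case: alt => [|[xk sel aw bef]]; [by left|right; split=> //].
exact: leq_ltn_trans xk.
Qed.

(** The core of strategyproofness, by cases on whether the misreport makes [i] late and whether her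
    price is revisable. Revisability does not depend on her report, and lateness under the misreport
    implies lateness under the truth. *)
Lemma truthful_price k' : departure (Th' i) <= departure (Th i) ->
  (x' <= k' <= y')%N -> winning Th' i base x' k' ->
  (winning_price Th' i k' <= (value (Th i))%:E)%E ->
  exists k,
    M_ Th =
      Some (Allocation i (departure (Th i)) (fine (winning_price Th i k))) /\
    (winning_price Th i k <= winning_price Th' i k')%E.
Proof.
move=> /y_le yy /andP[xk ky] win.
have lateT : late Th' i -> late Th i.
  rewrite /late others_base => lat; apply: leq_trans lat _.
  apply: subset_leq_card.
  have [q ->] := run_take_split Th i yy.
  by rewrite departures_cat subsetUl.
have revT : revisable Th' i = revisable Th i by rewrite /revisable others_final.
have priceT : winning_price Th' i k' =
    if late Th' i && revisable Th i then threshold final else threshold (s_ k').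
  by rewrite /winning_price revT others_base others_run others_final.
have xx' := x_le.
have xky : (x <= k' <= y)%N by rewrite (leq_trans xx' xk) (leq_trans ky yy).
rewrite {}priceT; case lat: (late Th' i) => /=; last first.
  move=> /(winning_truth win)/(winning_outcome vTh xky).
  case=> k [/andP[xk' kk] le_thr out].
  (* Position [k'] precedes the third phase, so the finite threshold at [k] is still in force
     there. *)
  exists k; split=> //; apply: le_trans (winning_price_le vTh i k) _.
  have [q Eq] := run_take_split Th i kk.
  rewrite Eq threshold_stable -?Eq //; first exact: coherent_take_base.
    by apply: contraTneq le_thr => ->; rewrite leye_eq.
  move: lat; rewrite /late others_base => /negbT; rewrite -ltnNge => lt.
  rewrite (leq_ltn_trans _ lt) //; apply: subset_leq_card.
  have [r ->] := run_take_split Th i ky.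
  by rewrite departures_cat subsetUl.
have late_y' : (M <= #|departures (take y' base)|)%N by rewrite -others_base.
case rev: (revisable Th i).
  rewrite /= => le_final.
  (* The truthful price is then the final threshold too, wherever [i] is selected, so any winning
     position will do. *)
  suff [k0 [xky0 win0]] : exists k0, (x <= k0 <= y)%N /\ winning Th i base x k0.
    have [k [_ _ out]] := winning_outcome vTh xky0 win0.
    by exists k; rewrite /winning_price lateT // rev in out *.
  case sel_k': (selected (s_ k')) => [j|].
    exists k'; split=> //; apply: (winning_truth win).
    by rewrite -final_selected ?sel_k'.
  case sel_y': (selected (s_ y')) => [j|]; last first.
    exists y'; rewrite yy (leq_trans xx' (leq_trans xk ky)); split=> //.
    split; last by left.
    by have [<- _] := final_late vTh late_y' sel_y'.
  (* The run of the others stops at some [l.+1] between [k'] and [y']. With an active winner there,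
     [rev] gives [i] the tie at [l.+1]; otherwise the threshold at [l] is already final and [l] is
     winning. *)
  have [] := @first_change (fun k => selected (s_ k)) k' y' => //.
  - by rewrite sel_k'.
  - by rewrite sel_y'.
  move=> l [/andP[kl ly] /negbTE + sel_l1].
  case sel_l: (selected (s_ l)) => [//|] _.
  have final_l := final_selected sel_l1; rewrite final_l in le_final.
  have xl : (x <= l)%N by apply: leq_trans kl; case/andP: xky.
  move: rev; rewrite /revisable final_l.
  case: (boolP (active_winner _)) => [aw bef|naw _].
    exists l.+1; rewrite leqW // (leq_trans ly yy); split=> //; split=> //.
    by right; split.
  exists l; rewrite xl (leq_trans (ltnW ly) yy); split=> //; split; last by left.
  have lbase : (l < size base)%N.
    rewrite ltnNge; apply/negP => sl; move: sel_l1.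
    by rewrite take_oversize ?leqW // -(take_oversize sl) sel_l.
  move: naw le_final sel_l1; rewrite (take_nth (Arrival i)) //.
  by move=> naw + sel_l1; rewrite passive_selection.
rewrite /= => le_k'; have win_k' := winning_truth win le_k'.
have [k [/andP[xk' kk] le_thr out]] := winning_outcome vTh xky win_k'.
exists k; split=> //; rewrite /winning_price rev andbF.
(* A drop between [k] and [k'] would mean that the third phase has begun by [k']; either alternative
   of [winning] at [k'] then makes the price revisable, against [rev]. *)
have [//|lt_thr] := leP (threshold (s_ k)) (threshold (s_ k')).
have [q Eq] := run_take_split Th i kk.
have fin : threshold (s_ k) != +oo%E.
  by apply: contraTneq le_thr => ->; rewrite leye_eq.
have late_k' : (M <= #|departures (take k' base)|)%N.
  rewrite leqNgt; apply: contraTN lt_thr => lt.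
  rewrite Eq threshold_stable -?Eq ?lt ?ltxx //.
  exact: coherent_take_base.
move: rev; rewrite /revisable; case: win => _; rewrite !others_run.
case=> [sel|[_ _ _ bef]].
  by have [_ ->] := final_late vTh late_k' sel.
rewrite (@final_selected Th i k'); last by case: selected bef.
by rewrite bef orbT.
Qed.

Lemma misreport_utility :
  utility (Th i) i (M_ Th') <= utility (Th i) i (M_ Th).
Proof.
case out: (M_ Th') => [a|]; last exact: utility_ge0.
rewrite {1}/utility; case: eqP => [wi|_]; last exact: utility_ge0.
have [k' [xky win ->]] := outcome_win vTh' out wi; rewrite /=.
rewrite others_base in xky win.
have P0 := winning_price_ge0 vTh' i k'.
have fP0 := fine_ge0 P0.
(* The item comes at the reported departure. Outside the true interval the utility is minus a
   nonnegative price; inside, the reported departure is no later than the true one. *)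
case: ifP => [/andP[_ dep]|_]; last first.
  by rewrite (le_trans _ (utility_ge0 vTh i)) // sub0r oppr_le0.
have [le|lt] := lerP (value (Th i)) (fine (winning_price Th' i k')).
  by rewrite (le_trans _ (utility_ge0 vTh i)) // subr_le0.
have finP' : (winning_price Th' i k' \is a fin_num)%E.
  rewrite ge0_fin_numE //.
  have := winning_price_le vTh' i k'; rewrite others_base.
  case: win => + _ => thr le; apply: le_lt_trans (le_trans le thr) _.
  exact: ltry.
have leP' : (winning_price Th' i k' <= (value (Th i))%:E)%E.
  by rewrite -(fineK finP') lee_fin ltW.
have [k [-> le]] := truthful_price dep xky win leP'.
rewrite /utility /= eqxx lexx (proj1 (vTh i)) /= lerD2l lerN2 fine_le //.
rewrite ge0_fin_numE ?winning_price_ge0 // (le_lt_trans le) //.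
by rewrite -ge0_fin_numE.
Qed.

End Misreport.

Lemma error_tolerant_time_strategyproof :
  time_strategyproof (error_tolerant pi alpha gamma prediction).
Proof.
move=> Th i r vTh vr arr; apply: misreport_utility => //.
- by move=> j; rewrite /with_report; case: eqP.
- by move=> j ji; rewrite /with_report (negbTE ji).
- by rewrite /with_report eqxx.
Qed.

Lemma error_tolerant_value_strategyproof :
  value_strategyproof (error_tolerant pi alpha gamma prediction).
Proof.
move=> Th i w vTh w0; apply: error_tolerant_time_strategyproof => //.
by split=> //; case: (vTh i).
Qed.

(** * The online property *)

Section Online.
Variables (Th Th' : profile R n) (t : R).
Hypothesis vTh : valid_profile Th.
Hypothesis vTh' : valid_profile Th'.
Hypothesis agree :
  forall j, arrival (Th j) <= t \/ arrival (Th' j) <= t -> Th j = Th' j.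

Lemma arrival_le_event_time (Th0 : profile R n) e : valid_profile Th0 ->
  arrival (Th0 (bidder_of e)) <= event_time Th0 e.
Proof. by move=> vTh0; case: e => j //=; case: (vTh0 j). Qed.

Lemma event_time_agree e :
  (event_time Th e <= t) || (event_time Th' e <= t) ->
  Th (bidder_of e) = Th' (bidder_of e).
Proof.
by case/orP=> le; apply: agree; [left|right];
  apply: le_trans le; apply: arrival_le_event_time.
Qed.

Lemma event_time_leE e : (event_time Th e <= t) = (event_time Th' e <= t).
Proof.
have timeE : (event_time Th e <= t) || (event_time Th' e <= t) ->
    event_time Th e = event_time Th' e.
  by move/event_time_agree; case: e => j /= ->.
by apply/idP/idP => le; move: (le); rewrite timeE // le ?orbT.
Qed.

Lemma events_time_cat (Th0 : profile R n) (S : {set 'I_n}) :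
  events pi Th0 S = [seq e <- events pi Th0 S | event_time Th0 e <= t] ++
                    [seq e <- events pi Th0 S | ~~ (event_time Th0 e <= t)].
Proof.
apply: (sorted_eq (event_le_trans (Th := Th0)) (event_le_anti (Th := Th0))).
- exact: events_sorted.
- have := events_sorted Th0 S.
  rewrite !(sorted_pairwise (event_le_trans (Th := Th0))) pairwise_cat => so.
  rewrite !pairwise_filter // !andbT; apply/allrelP => e f.
  rewrite !mem_filter -ltNge => /andP[le _] /andP[lt _].
  by rewrite /event_le (le_lt_trans le lt).
- by rewrite perm_sym; apply/permPl/perm_filterC.
Qed.

(** A bidder with an event by time [t] has arrived by then, so both profiles give her the same type
    and the events up to [t] form a common prefix. *)
Lemma events_agree (S : {set 'I_n}) : exists l r r',
  [/\ events pi Th S = l ++ r, events pi Th' S = l ++ r',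
      run Th l = run Th' l
    & forall e, (e \in l) = (bidder_of e \in S) && (event_time Th e <= t)].
Proof.
rewrite (events_time_cat Th S) (events_time_cat Th' S).
set l := [seq e <- _ | event_time Th e <= t]; set r := [seq e <- _ | _].
set l' := [seq e <- _ | event_time Th' e <= t]; set r' := [seq e <- _ | _].
have ml e : (e \in l) = (bidder_of e \in S) && (event_time Th e <= t).
  by rewrite mem_filter mem_events andbC.
have ml' e : (e \in l') = (e \in l).
  by rewrite ml mem_filter mem_events andbC event_time_leE.
have leE e : e \in l -> Th (bidder_of e) = Th' (bidder_of e).
  by rewrite ml => /andP[_ le]; apply: event_time_agree; rewrite le.
have <- : l = l'.
  apply: (sorted_eq (event_le_trans (Th := Th)) (event_le_anti (Th := Th))).
  - exact/sorted_filter/events_sorted/event_le_trans.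
  - rewrite (@eq_in_sorted _ (mem l) _ (event_le pi Th')).
    + exact/sorted_filter/events_sorted/event_le_trans.
    + by move=> e f el fl; apply: event_le_eq; apply: leE.
    + by apply/allP => e; rewrite ml'.
  - by apply: uniq_perm => [||e]; rewrite ?ml' // filter_uniq ?events_uniq.
by exists l, r, r'; split=> //; apply: run_eq.
Qed.

Lemma departs_before_agree i j : Th i = Th' i -> departure (Th i) <= t ->
  departs_before Th j i = departs_before Th' j i.
Proof.
move=> eqi dep.
have eqj : departs_before Th j i || departs_before Th' j i -> Th j = Th' j.
  rewrite /departs_before; case/orP=> H; apply: agree; [left|right].
    apply: le_trans (proj1 (vTh j)) (le_trans _ dep).
    by case/orP: H => [/ltW//|/andP[/eqP-> _]].
  apply: le_trans (proj1 (vTh' j)) (le_trans _ dep); rewrite eqi.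
  by case/orP: H => [/ltW//|/andP[/eqP-> _]].
have eqd : Th j = Th' j -> departs_before Th j i = departs_before Th' j i.
  by move=> eqj0; rewrite /departs_before eqi eqj0.
by apply/idP/idP => H; move: (H); rewrite eqd // eqj // H ?orbT.
Qed.

Lemma error_tolerant_agree i p :
  error_tolerant pi alpha gamma prediction Th = Some (Allocation i t p) ->
  error_tolerant pi alpha gamma prediction Th' = Some (Allocation i t p).
Proof.
rewrite /error_tolerant; case sel: selected => [j|//] [ji dep <-].
rewrite {}ji in sel dep *.
have eqi : Th i = Th' i.
  by apply: agree; left; rewrite -dep; case: (vTh i).
(* [i] departs at [t] and is selected by then, that is, within the common prefix; what follows
   leaves the state unchanged. *)
have allocE : alloc pi alpha gamma prediction Th' setT =
              alloc pi alpha gamma prediction Th setT.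
  have [l [r [r' [E E' El ml]]]] := events_agree setT.
  move: sel; rewrite !alloc_run E E' => sel.
  have cl : coherent (l ++ r) by rewrite -E; apply: events_coherent.
  have selT : selected (run Th l) = Some i.
    by apply: selected_before_departure cl _ sel; rewrite ml inE /= dep.
  rewrite !run_cat run_from_selected -El ?selT //.
  by rewrite run_from_selected ?selT.
rewrite allocE sel -eqi dep; congr (Some (Allocation _ _ (fine _))).
rewrite /payment !departure_indexE.
have -> : [set j | departs_before Th' j i] = [set j | departs_before Th j i].
  by apply/setP => k; rewrite !inE departs_before_agree // dep.
case: ifP => // /andP[_]; rewrite ltnS => late.
have [l [r [r' [E E' El ml]]]] := events_agree [set~ i].
rewrite !alloc_run E E'.
case sel_l: (selected (run Th l)) => [k|].
  rewrite !run_cat (run_from_selected Th') -El ?sel_l //.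
  by rewrite run_from_selected ?sel_l.
(* The bidders departing before [i] do so by time [t], so the rerun is in the third phase after the
   common prefix. From there the threshold is final and there is no active winner, which makes
   [payment] ignore whom the rerun selects. *)
have late_l : (M <= #|departures l|)%N.
  apply: leq_trans late (subset_leq_card _).
  apply/subsetP => k.
  rewrite !inE ml !inE => before; apply/andP; split.
    apply: contraTneq before => /= ->.
    by rewrite /departs_before ltxx eqxx /before ltnn.
  by case/orP: before => [/ltW|/andP[/eqP]] /=; rewrite dep // => ->.
have cl : coherent (l ++ r) by rewrite -E; apply: events_coherent.
have cl' : coherent (l ++ r') by rewrite -E'; apply: events_coherent.
have [-> ->] := third_phase_final cl late_l sel_l.
rewrite El in sel_l *.
by have [-> ->] := third_phase_final cl' late_l sel_l.
Qed.

End Online.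

Lemma error_tolerant_online : online (error_tolerant pi alpha gamma prediction).
Proof.
by move=> Th Th' t vTh vTh' agree i p; apply: error_tolerant_agree.
Qed.

(** * Revenue *)

Section Revenue.
Variable Th : profile R n.
Hypothesis vTh : valid_profile Th.

Local Notation v := (fun j => value (Th j)).
Local Notation alloc_ := (alloc pi alpha gamma prediction Th).
Local Notation M_ := (error_tolerant pi alpha gamma prediction).
Local Notation before_in S h := [set j in S | departs_before Th j h].

Lemma departs_before_irr i : departs_before Th i i = false.
Proof. by rewrite /departs_before ltxx eqxx /before ltnn. Qed.

Lemma departure_index_lt i j : departs_before Th i j ->
  (departure_index pi Th i < departure_index pi Th j)%N.
Proof.
move=> bij; rewrite !departure_indexE ltnS; apply: proper_card.
apply/properP; split; last by exists i; rewrite inE ?departs_before_irr.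
move: bij; rewrite -event_le_departure => /andP[neij leij].
apply/subsetP => k; rewrite !inE -!event_le_departure.
case/andP=> neki leki; rewrite (event_le_trans leki leij) andbT.
apply: contraNneq neij => eqkj; apply/eqP/(event_le_anti (Th := Th)).
by rewrite leij -eqkj.
Qed.

Lemma departure_index_inj : injective (departure_index pi Th).
Proof.
move=> i j eqij; apply/eqP; apply: contraTT isT => neij.
have : departs_before Th i j || departs_before Th j i.
  rewrite -!event_le_departure !(inj_eq (@departure_inj n)) (eq_sym j) neij.
  exact: event_le_total.
by case/orP=> /departure_index_lt; rewrite eqij ltnn.
Qed.

(** The index minus one is an injection of ['I_n] into itself, so preimages keep their
    cardinality. *)
Lemma card_departure_index_le c : (c <= n)%N ->
  #|[set i | (departure_index pi Th i <= c)%N]| = c.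
Proof.
move=> cn; have idx_lt i : ((departure_index pi Th i).-1 < n)%N.
  rewrite departure_indexE /=.
  have /subset_leq_card : [set j | departs_before Th j i] \subset [set~ i].
    apply/subsetP => j; rewrite !inE; apply: contraTneq => ->.
    by rewrite departs_before_irr.
  rewrite cardsC1 card_ord => /leq_ltn_trans; apply.
  by rewrite ltn_predL (leq_ltn_trans _ (ltn_ord i)).
pose f i := Ordinal (idx_lt i).
have f_inj : injective f.
  move=> i j /(congr1 val) /= eqij; apply: departure_index_inj.
  by rewrite !departure_indexE; congr _.+1.
have -> : [set i | (departure_index pi Th i <= c)%N] =
    f @^-1: [set k : 'I_n | (k < c)%N] by apply/setP => i; rewrite !inE.
rewrite card_preimset // -sum1dep_card -(big_ord_widen n (fun=> 1%N)) //.
by rewrite sum1_card card_ord.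
Qed.

Lemma alloc_threshold_fin (S : {set 'I_n}) : selected (alloc_ S) ->
  threshold (alloc_ S) != +oo%E.
Proof.
case sel: (selected _) => [i|//] _.
have [_] := run_selected (runP Th (events_coherent vTh S)) sel.
by apply: contraTneq => ->; rewrite leye_eq.
Qed.

Lemma fine_ge (c : R) (t : \bar R) :
  t != +oo%E -> (c%:E <= t)%E -> c <= fine t.
Proof. by case: t => //= t _; rewrite lee_fin. Qed.

(** Just before departing, [h] is active; with nobody selected, her value would be below the
    threshold, which the hypothesis bounds by that value. *)
Lemma selected_by_departure (S : {set 'I_n}) h : h \in S ->
  (forall j, v j <= v h) ->
  (forall vm, vm <= v h -> (stage_threshold #|before_in S h| vm <= (v h)%:E)%E) ->
  exists p q, [/\ events pi Th S = p ++ q, departures p = before_in S h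
                & selected (run Th p)].
Proof.
move=> hS hmax thr_le; have [p [q [E Ap Dp]]] := departures_split vTh hS.
exists p, (Departure h :: q); split=> //; case sel: (selected _) => [//|].
have cp : coherent p.
  apply: (@coherent_prefix _ p (Departure h :: q)).
  by rewrite -E; apply: events_coherent.
have [depE actE _ low] := run_unselected (runP Th cp) sel.
have hact : h \in active (run Th p).
  rewrite actE inE Ap /=; have /setP/(_ h) := Dp.
  by rewrite !inE departs_before_irr andbF => ->.
have := low h hact; rewrite ltNge (run_threshold (runP Th cp)) depE Dp thr_le //.
by apply: (run_vmax_le (runP Th cp)) => //; case: (vTh h).
Qed.

(** The sale occurs by the departure of [h], hence before the third phase, where every threshold is
    infinite or at least [g]. *)
Lemma prediction_threshold (S : {set 'I_n}) h : h \in S ->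
  (forall j, v j <= v h) -> g <= v h -> (K <= #|before_in S h| < M)%N ->
  selected (alloc_ S) /\ (g%:E <= threshold (alloc_ S))%E.
Proof.
move=> hS hmax gh /andP[Kk kM].
have [|p [q [E Dp sel]]] := selected_by_departure hS hmax.
  by move=> vm le; rewrite /stage_threshold leqNgt kM Kk lee_fin ge_max le.
have cp : coherent p.
  by apply: (@coherent_prefix _ p q); rewrite -E; apply: events_coherent.
rewrite alloc_run E run_cat run_from_selected // sel; split=> //.
rewrite (run_threshold (runP Th cp)) /stage_threshold leqNgt.
rewrite (leq_ltn_trans _ kM) /=; last first.
  by rewrite -Dp; apply/subset_leq_card/(run_departed (runP Th cp)).
by case: ifP => _; [rewrite lee_fin le_max lexx orbT|apply: leey].
Qed.

(** Only a revised price needs care. It concerns a winner departing after the second phase, thus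
    after [h], whose removal leaves the number of departures before [h] unchanged. *)
Lemma revenue_ge_prediction h :
  (forall j, v j <= v h) -> g <= v h ->
  (K < departure_index pi Th h <= M)%N -> g <= revenue (M_ Th).
Proof.
move=> hmax gh idx; have [|sel thr] := prediction_threshold (in_setT h) hmax gh.
  by rewrite (_ : [set j in _ | _] = [set j | departs_before Th j h]) //;
    apply/setP => j; rewrite !inE.
have fin := alloc_threshold_fin sel.
rewrite /error_tolerant; case: (selected _) sel => [i _|//] /=.
rewrite /payment; case: ifP => [/andP[_ idx_i]|_]; last exact: fine_ge.
case: ifP => _; last exact: fine_ge.
have /andP[Kh hM] := idx.
have not_before : ~~ departs_before Th i h.
  apply: contraTN idx_i => /departure_index_lt/ltnW le.
  by rewrite -leqNgt (leq_trans le).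
have hi : h \in [set~ i].
  by rewrite !inE; apply: contraTneq idx_i => <-; rewrite -leqNgt.
have [|sel' thr'] := prediction_threshold hi hmax gh.
  rewrite (_ : [set j in _ | _] = [set j | departs_before Th j h]) //.
  apply/setP => j; rewrite !inE; have [->|//] := eqVneq j i.
  exact/esym/negbTE.
by apply: fine_ge => //; apply: alloc_threshold_fin.
Qed.

Lemma departed_prefix l : coherent l ->
  exists p q, l = p ++ q /\ departed (run Th l) = departures p.
Proof.
elim/last_ind: l => [|l e IH] cl.
  by exists [::], [::]; split=> //; apply/setP => j; rewrite !inE.
have cl0 : coherent l := coherent_rcons cl.
case sel: (selected (run Th l)) => [i|].
  have [p [q [Ep Dp]]] := IH cl0; exists p, (rcons q e).
  by rewrite run_rcons step_selected ?sel // -rcons_cat -Ep.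
exists (rcons l e), [::]; rewrite cats0; split=> //.
have [depE _ _ _] := run_unselected (runP Th cl0) sel.
rewrite run_rcons /step sel; case: e cl => i _ /=.
  by rewrite departures_rcons_arrival.
by rewrite departures_rcons_departure depE.
Qed.

(** If [h] has departed when the run stops, [vmax] covers her value. Otherwise so few have departed
    that the threshold is infinite, or at least [g] and [v h <= g]. *)
Lemma threshold_ge_value (S : {set 'I_n}) h : h \in S ->
  (#|before_in S h| < K)%N || (#|before_in S h| < M)%N && (v h <= g) ->
  ((v h)%:E <= threshold (alloc_ S))%E.
Proof.
move=> hS early; have cS := events_coherent vTh S.
have [p [q [E Dp]]] := departed_prefix cS.
rewrite alloc_run (run_threshold (runP Th cS)).
have [hd|hnd] := boolP (h \in departures p).
  apply: le_trans (stage_threshold_ge _ _); rewrite lee_fin.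
  by apply: (run_vmax_ge (runP Th cS)); rewrite Dp.
have few : (#|departed (run Th (events pi Th S))| <= #|before_in S h|)%N.
  rewrite Dp; apply/subset_leq_card/subsetP => j; rewrite !inE => jp.
  have : Departure j \in events pi Th S by rewrite E mem_cat jp.
  rewrite mem_events /= => -> /=; rewrite -event_le_departure.
  have hq : Departure h \in q.
    have : Departure h \in events pi Th S by rewrite mem_events.
    by rewrite E mem_cat; move: hnd; rewrite inE => /negbTE ->.
  apply/andP; split; first by apply: contraNneq hnd => -[<-]; rewrite inE.
  have := events_sorted Th S.
  rewrite (sorted_pairwise (event_le_trans (Th := Th))).
  by rewrite E pairwise_cat => /andP[/allrelP ->].
rewrite /stage_threshold; case/orP: early => [early|/andP[early vg]].
  have lt := leq_ltn_trans few early.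
  by rewrite leqNgt (leq_trans lt KM) leqNgt lt leey.
rewrite leqNgt (leq_ltn_trans few early) /=.
by case: ifP => _; rewrite ?leey // lee_fin le_max vg orbT.
Qed.

Lemma late_rerun_fin i : (M < departure_index pi Th i)%N ->
  threshold (alloc_ [set~ i]) != +oo%E.
Proof.
rewrite departure_indexE ltnS => late; have cS := events_coherent vTh [set~ i].
case sel: (selected (alloc_ [set~ i])) => [j|].
  by apply: alloc_threshold_fin; rewrite sel.
apply: third_phase_threshold_fin cS _ sel.
apply: leq_trans late (subset_leq_card _); apply/subsetP => j.
rewrite !inE mem_events !inE /=; apply: contraTneq => ->.
by rewrite departs_before_irr.
Qed.

Lemma revenue_ge_value h1 h2 :
  (forall j, v j <= v h1) ->
  (departure_index pi Th h2 <= (if (g <= v h1)%R then K else M)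
     < departure_index pi Th h1)%N ->
  v h2 <= revenue (M_ Th).
Proof.
move=> hmax; rewrite !departure_indexE ltnS.
set k2 := #|_|; set k1 := #|_| => /andP[early late].
have early2 (S : {set 'I_n}) : (#|before_in S h2| < K)%N ||
    (#|before_in S h2| < M)%N && (v h2 <= g).
  have le : (#|before_in S h2| <= k2)%N.
    by apply/subset_leq_card/subsetP => j; rewrite !inE => /andP[].
  move: early; case: ifP => [_|/negbT]; first by move/(leq_ltn_trans le) ->.
  rewrite -ltNge => lt /(leq_ltn_trans le) ->.
  by rewrite (le_trans (hmax h2) (ltW lt)) orbT.
have thr := threshold_ge_value (in_setT h2) (early2 _).
(* When [h1] departs, the threshold is [vm], or [Num.max vm g] with [g <= v h1], so the item is sold
   by then. *)
have sel : selected (alloc_ setT).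
  have [|p [q [E _ selp]]] := selected_by_departure (in_setT h1) hmax.
    rewrite (_ : [set j in _ | _] = [set j | departs_before Th j h1]); last first.
      by apply/setP => j; rewrite !inE.
    move=> vm le; rewrite /stage_threshold -/k1; move: late.
    case: ifP => [gh ->|_ ->]; last by rewrite lee_fin.
    by case: ifP => _; rewrite lee_fin // ge_max le.
  by rewrite alloc_run E run_cat run_from_selected.
have fin := alloc_threshold_fin sel.
rewrite /error_tolerant; case: (selected _) sel => [i _|//] /=.
rewrite /payment; case: ifP => [/andP[_ idx_i]|_]; last exact: fine_ge.
case: ifP => _; last exact: fine_ge.
(* A revised price concerns a winner departing after the start of the third phase, hence not
   [h2]. *)
have hi : h2 \in [set~ i].
  rewrite !inE; apply: contraTneq idx_i => <-; rewrite departure_indexE -leqNgt.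
  by apply: leq_trans early _; case: ifP.
by apply: fine_ge; [exact: late_rerun_fin|exact: threshold_ge_value].
Qed.

Lemma revenue_ge0 : 0 <= revenue (M_ Th).
Proof.
rewrite /error_tolerant; case: (selected _) => [i|//] /=; apply: fine_ge0.
have thr0 (S : {set 'I_n}) : (0 <= threshold (alloc_ S))%E.
  by rewrite alloc_run; apply/threshold_ge0/events_coherent.
rewrite /payment; case: ifP => _; last exact: (thr0 setT).
by case: ifP => _; exact: thr0.
Qed.

End Revenue.


End Run.

(** * Random matchings *)

Section RandomMatching.
Variables (R : realType) (n : nat).

Lemma card_as_sum (T : finType) (P : pred T) :
  #|[set x | P x]| = (\sum_x P x)%N.
Proof.
by rewrite -sum1dep_card big_mkcond; apply: eq_bigr => x _; case: (P x).
Qed.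

Lemma sum_perm_mem (s : 'S_n) (D : {set 'I_n}) : (\sum_x (s x \in D) = #|D|)%N.
Proof.
rewrite -sum1_card [RHS]big_mkcond [RHS](reindex_inj (@perm_inj _ s)).
by apply: eq_bigr => x _; case: ifP.
Qed.

(** Double counting over ordered pairs of values. Each permutation contributes [#|D| * #|~: D|];
    off-diagonal pairs are equivalent by relabelling and diagonal ones contribute nothing, which is
    the slack in counting [n ^ 2] pairs. *)
Lemma card_perm_pair (a b : 'I_n) (D : {set 'I_n}) : a != b ->
  (n`! * (#|D| * #|~: D|) <=
   n ^ 2 * #|[set s : 'S_n | ((s^-1)%g a \in D) && ((s^-1)%g b \notin D)]|)%N.
Proof.
move=> ab.
pose P (x y : 'I_n) (s : 'S_n) :=
  ((s^-1)%g x \in D) && ((s^-1)%g y \notin D).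
have relabel x y : (\sum_(s : 'S_n) P x y s <= \sum_(s : 'S_n) P a b s)%N.
  have [->|xy] := eqVneq x y.
    by rewrite big1 // => s _; rewrite /P andbN.
  (* A permutation taking [x] to [a] and [y] to [b]: the second transposition corrects the image of
     [y] and fixes [a]. *)
  pose t := (tperm x a * tperm (tperm x a y) b)%g.
  have tx : t x = a.
    rewrite permM tpermL tpermD // eq_sym // -{1}(tpermL x a).
    by rewrite (inj_eq perm_inj).
  have ty : t y = b by rewrite permM tpermL.
  rewrite [leqRHS](reindex_inj (mulIg t)) /=; apply: leq_sum => s _.
  have ta : (t^-1)%g a = x by rewrite -tx permK.
  have tb : (t^-1)%g b = y by rewrite -ty permK.
  by rewrite /P invMg !permM ta tb.
have -> : #|[set s | P a b s]| = (\sum_(s : 'S_n) P a b s)%N.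
  exact: card_as_sum.
have <- : (\sum_(s : 'S_n) \sum_x \sum_y P x y s = n`! * (#|D| * #|~: D|))%N.
  transitivity (\sum_(s : 'S_n) #|D| * #|~: D|)%N; last first.
    by rewrite sum_nat_const card_Sn.
  apply: eq_bigr => s _.
  rewrite -(sum_perm_mem s^-1 D) -(sum_perm_mem s^-1 (~: D)) big_distrl.
  apply: eq_bigr => x _.
  rewrite big_distrr; apply: eq_bigr => y _.
  by rewrite /P inE /= mulnb.
rewrite exchange_big; under eq_bigr => x _ do rewrite exchange_big /=.
apply: (@leq_trans (\sum_(x < n) \sum_(y < n) \sum_(s : 'S_n) P a b s)%N).
  by apply: leq_sum => x _; apply: leq_sum.
by rewrite !sum_nat_const !card_ord mulnA.
Qed.

Lemma card_perm_point (a : 'I_n) (D : {set 'I_n}) :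
  (n * #|[set s : 'S_n | (s^-1)%g a \in D]| = n`! * #|D|)%N.
Proof.
have relabel x : (\sum_(s : 'S_n) ((s^-1)%g x \in D) =
                  \sum_(s : 'S_n) ((s^-1)%g a \in D))%N.
  rewrite [RHS](reindex_inj (mulIg (tperm x a))) /=; apply: eq_bigr => s _.
  by rewrite invMg permM tpermV tpermR.
transitivity (\sum_x \sum_(s : 'S_n) ((s^-1)%g x \in D))%N.
  rewrite card_as_sum (eq_bigr _ (fun x _ => relabel x)).
  by rewrite sum_nat_const card_ord.
rewrite exchange_big /=; under eq_bigr => s _ do rewrite sum_perm_mem.
by rewrite sum_nat_const card_Sn.
Qed.

Lemma expected_revenue_ge (M : auction R n) (V : n.-tuple R)
    (Iv : 'I_n -> R * R) (G : {set 'S_n}) (c : R) :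
  (forall s, 0 <= revenue (M (matching V Iv s))) ->
  (forall s, s \in G -> c <= revenue (M (matching V Iv s))) ->
  c * (#|G|%:R / n`!%:R) <= expected_revenue M V Iv.
Proof.
move=> rev0 revG; rewrite /expected_revenue card_Sn mulrA.
rewrite ler_wpM2r ?invr_ge0 ?ler0n // mulr_natr -sumr_const big_mkcond.
by apply: ler_sum => s _; case: ifP => [/revG|].
Qed.

(** Indexing by a permutation keeps the highest and second-highest values at distinct indices even
    when they are equal. *)
Lemma kth_highest_index (V : n.-tuple R) : exists p : 'S_n,
  (forall k : 'I_n, tnth V (p k) = kth_highest V k.+1) /\
  {homo (fun k => tnth V (p k)) : k l / (k <= l)%N >-> l <= k}.
Proof.
have /tuple_permP[p Ep] : perm_eq (sort >=%R V) V by rewrite perm_sort.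
have nthE (k : 'I_n) : (sort >=%R V)`_k = tnth V (p k).
  by rewrite Ep -[LHS]/(nth 0 _ k) -tnth_nth tnth_mktuple.
exists p; split=> [k|k l kl]; first by rewrite -nthE.
rewrite -!nthE; apply: (@sorted_leq_nth _ >=%R) => //.
- by move=> x y z /= yx zy; apply: le_trans yx.
- by move=> x /=.
- exact/sort_sorted/ge_total.
- by rewrite inE size_sort size_tuple.
- by rewrite inE size_sort size_tuple.
Qed.

(** Integrality in [parameter_set] makes the ceiling and the floor exact. *)
Lemma phase_starts (alpha : R) : parameter_set n alpha ->
  let K := second_phase_start n alpha in let M := third_phase_start n alpha in
  [/\ K%:R = (1 - alpha) / 2 * n%:R :> R, M%:R = (1 + alpha) / 2 * n%:R :> R,
      (K <= M)%N & (K + M = n)%N].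
Proof.
case=> _ /natrP[m Em] /natrP[k Ek] K M.
have EM : (1 + alpha) / 2 * n%:R = (m + k)%:R.
  rewrite natrD -Em -Ek -mulrDl; congr (_ * _).
  by rewrite [LHS](_ : _ = alpha + (1 - alpha) / 2) //; field.
have -> : K = k.
  rewrite /K /second_phase_start Ek.
  have -> : Num.ceil (k%:R : R) = k%:Z.
    by apply: (@intr_inj R); rewrite ceilK ?natr_int.
  by [].
have -> : M = (m + k)%N.
  rewrite /M /third_phase_start EM.
  have -> : Num.floor ((m + k)%:R : R) = (m + k)%:Z.
    by apply: (@intr_inj R); rewrite floorK ?natr_int.
  by [].
split=> //; first exact: leq_addl.
apply: (@mulrIn R 1); rewrite ?oner_eq0 // natrD -EM -Ek -mulrDl.
by rewrite [X in X * _](_ : _ = 1) ?mul1r //; field.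
Qed.

(** * Bounds on the expected revenue *)

Section Bounds.
Variables (pi : 'S_n) (alpha gamma prediction : R).
Hypothesis alphaW : parameter_set n alpha.
Hypothesis n_gt0 : (0 < n)%N.
Variables (V : n.-tuple R) (Iv : 'I_n -> R * R).
Hypothesis V_ge0 : forall i, 0 <= tnth V i.
Hypothesis Iv_le : forall i, (Iv i).1 <= (Iv i).2.

Local Notation K := (second_phase_start n alpha).
Local Notation M := (third_phase_start n alpha).
Local Notation g := (gamma * prediction).
Local Notation M_ := (error_tolerant pi alpha gamma prediction).
(** Departure indices depend on the intervals only, so the identity matching stands for all
    matchings. *)
Local Notation index := (departure_index pi (matching V Iv 1)).

Let KM : (K <= M)%N. Proof. by have [] := phase_starts alphaW. Qed.
Let KMn : (K + M = n)%N. Proof. by have [] := phase_starts alphaW. Qed.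

Let Kn : (K <= n)%N. Proof. by rewrite -[leqRHS]KMn leq_addr. Qed.
Let Mn : (M <= n)%N. Proof. by rewrite -[leqRHS]KMn leq_addl. Qed.

Let n_neq0 : n%:R != 0 :> R. Proof. by rewrite pnatr_eq0 -lt0n. Qed.

Let matching_valid s : valid_profile (matching V Iv s).
Proof. by move=> i; split=> /=. Qed.

Let revenue_matching_ge0 s : 0 <= revenue (M_ (matching V Iv s)).
Proof. exact: revenue_ge0. Qed.

Lemma value_matching s a : value (matching V Iv s ((s^-1)%g a)) = tnth V a.
Proof. by rewrite /= permKV. Qed.

Lemma card_index_le c : (c <= n)%N -> #|[set i | (index i <= c)%N]| = c.
Proof. exact: card_departure_index_le. Qed.

Lemma coefficientE : (1 - alpha ^+ 2) / 4 = (K * M)%:R / n%:R ^+ 2.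
Proof.
have [KE ME _ _] := phase_starts alphaW; rewrite natrM KE ME.
by field; rewrite n_neq0.
Qed.

Lemma expected_revenue_ge0 : 0 <= expected_revenue M_ V Iv.
Proof.
rewrite -[0](mul0r (#|@set0 'S_n|%:R / n`!%:R)).
by apply: expected_revenue_ge => // s; rewrite inE.
Qed.

Lemma expected_revenue_ge_prediction a :
  (forall k, tnth V k <= tnth V a) -> g <= tnth V a ->
  alpha * g <= expected_revenue M_ V Iv.
Proof.
move=> amax ga; pose D := [set i | (K < index i <= M)%N].
have cardD : #|D| = (M - K)%N.
  have -> : D = [set i | (index i <= M)%N] :\: [set i | (index i <= K)%N].
    by apply/setP => i; rewrite !inE -ltnNge.
  rewrite cardsD (setIidPr _); last first.
    by apply/subsetP => i; rewrite !inE => /leq_trans; apply.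
  by rewrite !card_index_le.
pose G := [set s : 'S_n | (s^-1)%g a \in D].
(* The highest value is uniformly placed, and [D] contains [M - K], that is [alpha * n], of the [n]
   positions. *)
have alphaE : alpha = #|G|%:R / n`!%:R.
  have fn0 : n`!%:R != 0 :> R by rewrite pnatr_eq0 -lt0n fact_gt0.
  have /(congr1 (fun k => k%:R : R)) := card_perm_point a D.
  rewrite -/G cardD !natrM natrB //.
  have [-> -> _ _] := phase_starts alphaW => EG.
  apply: (mulfI n_neq0); rewrite mulrA EG; field.
  by rewrite fn0.
rewrite {1}alphaE mulrC; apply: expected_revenue_ge => // s.
rewrite !inE => idx.
apply: (@revenue_ge_prediction _ _ pi _ _ _ KM _ _ ((s^-1)%g a)) => //.
  by move=> j; rewrite value_matching; apply: amax.
by rewrite value_matching.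
Qed.

Lemma expected_revenue_ge_second a b : a != b ->
  (forall k, tnth V k <= tnth V a) ->
  (1 - alpha ^+ 2) / 4 * tnth V b <= expected_revenue M_ V Iv.
Proof.
move=> ab amax; pose c := if g <= tnth V a then K else M.
pose D := [set i | (index i <= c)%N].
have cn : (c <= n)%N by rewrite /c; case: ifP.
(* Since [K + M = n], both choices of [c] split the positions into parts of sizes [K] and [M]. *)
have cardD : (#|D| * #|~: D| = K * M)%N.
  have nK : (n - K = M)%N by rewrite -[X in (X - _)%N]KMn addKn.
  have nM : (n - M = K)%N by rewrite -[X in (X - _)%N]KMn addnK.
  rewrite [#|~: D|]cardsCs setCK card_ord card_index_le // /c.
  by case: ifP => _; rewrite ?nK ?nM // mulnC.
pose G := [set s : 'S_n | ((s^-1)%g b \in D) && ((s^-1)%g a \notin D)].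
have coefG : (1 - alpha ^+ 2) / 4 <= #|G|%:R / n`!%:R.
  rewrite coefficientE ler_pdivrMr ?exprn_gt0 ?ltr0n //.
  rewrite mulrAC ler_pdivlMr ?ltr0n ?fact_gt0 //.
  rewrite -natrX -!natrM ler_nat mulnC [leqRHS]mulnC -cardD.
  by apply: card_perm_pair; rewrite eq_sym.
apply: le_trans (ler_wpM2r (V_ge0 b) coefG) _; rewrite mulrC.
apply: expected_revenue_ge => // s; rewrite !inE -ltnNge => idx.
rewrite -(value_matching s b).
apply: (@revenue_ge_value _ _ pi _ _ _ KM _ _ ((s^-1)%g a)) => //.
  by move=> j; rewrite value_matching; apply: amax.
by rewrite value_matching.
Qed.

End Bounds.
End RandomMatching.

(** * Assembly of the guarantees *)

Unset Implicit Arguments.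

Theorem theorem12 (R : realType) (n : nat) (n_gt0 : (0 < n)%N) (pi : 'S_n)
    (alpha gamma : R) (alphaW : parameter_set n alpha)
    (gamma01 : 0 <= gamma <= 1)
    (prediction : R) (prediction_ge0 : 0 <= prediction) :
  [/\ online (error_tolerant pi alpha gamma prediction),
      value_strategyproof (error_tolerant pi alpha gamma prediction),
      time_strategyproof (error_tolerant pi alpha gamma prediction)
    & forall (V : n.-tuple R) (Iv : 'I_n -> R * R),
        (forall i, 0 <= tnth V i) ->
        (forall i, (Iv i).1 <= (Iv i).2) ->
        let v1 := kth_highest V 1 in
        let v2 := kth_highest V 2 in
        let q := quality prediction v1 in
        (if gamma <= q
         then Num.max (alpha * gamma * q * v1) ((1 - alpha ^+ 2) / 4 * v2)
         else (1 - alpha ^+ 2) / 4 * v2)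
        <= expected_revenue (error_tolerant pi alpha gamma prediction) V Iv].
Proof.
have [_ _ KM KMn] := phase_starts alphaW.
split.
- exact: error_tolerant_online.
- exact: error_tolerant_value_strategyproof.
- exact: error_tolerant_time_strategyproof.
move=> V Iv V0 IvP /=; set E := expected_revenue _ _ _.
have [p [pE p_decr]] := kth_highest_index V.
have {pE} pE k (kn : (k < n)%N) : kth_highest V k.+1 = tnth V (p (Ordinal kn)).
  by rewrite pE.
have amax k : tnth V k <= tnth V (p (Ordinal n_gt0)).
  by rewrite -(permKV p k); apply: p_decr.
have second : (1 - alpha ^+ 2) / 4 * kth_highest V 2 <= E.
  (* If [K = 0] the coefficient vanishes, which covers [n = 1]; otherwise [n = K + M] is at least 2
     and a second value exists. *)
  have [K0|K_gt0] := posnP (second_phase_start n alpha).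
    rewrite (coefficientE alphaW n_gt0) K0 mul0n !mul0r.
    exact: expected_revenue_ge0.
  have n_gt1 : (1 < n)%N by rewrite -KMn -(addn1 1) leq_add // (leq_trans K_gt0).
  rewrite (pE 1%N n_gt1); apply: expected_revenue_ge_second amax => //.
  by rewrite (inj_eq perm_inj).
case: ifP => [gq|_]; rewrite ?ge_max // second andbT.
move: gq; rewrite (pE 0%N n_gt0) /quality; set v1 := tnth V _ => gq.
have [gamma0 _] := andP gamma01; have [/andP[alpha0 _] _ _] := alphaW.
have [v10|v1_neq0] := eqVneq v1 0.
  by rewrite v10 mulr0; apply: expected_revenue_ge0.
have v1_gt0 : 0 < v1 by rewrite lt_neqAle eq_sym v1_neq0 V0.
have [pred0|pred_neq0] := eqVneq prediction 0.
  (* Division by 0 gives 0, so the quality is 0 here. *)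
  rewrite pred0 mul0r invr0 mulr0 minxx mulr0 mul0r.
  exact: expected_revenue_ge0.
have pred_gt0 : 0 < prediction by rewrite lt_neqAle eq_sym pred_neq0.
(* The ratio [v1 / prediction] yields [g <= v1]; the other ratio, used last, yields that quality
   times [v1] is at most [prediction]. *)
move: gq; rewrite le_min => /andP[_]; rewrite ler_pdivlMr // => gv1.
apply: le_trans (expected_revenue_ge_prediction _ _ _ _ _ amax gv1) => //.
rewrite -mulrA -(mulrA alpha) ler_wpM2l // ler_wpM2l // -ler_pdivlMr //.
by rewrite ge_min lexx.
Qed.
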